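(* Let $p$ be a prime number and let $\lambda$ be an infinite cardinal. If $\lambda^{\aleph_0}=\lambda$ or $\forall \mu<\lambda\,(\mu^{\aleph_0}<\lambda)$ (where $\mu$ ranges over cardinals), then there is a universal abelian $p$-group for purity of cardinality $\lambda$. Moreover, for every integer $n\geq 2$, there is a universal abelian $p$-group for purity of cardinality $\aleph_n$ if and only if $2^{\aleph_0}\leq \aleph_n$.
   Context: An abelian $p$-group is an abelian group in which every nonzero element has order $p^n$ for some $n\in\mathbb{N}$. A subgroup $G$ of an abelian group $H$ is a pure subgroup, written $G\leq_p H$, if $nH\cap G=nG$ for every $n\in\mathbb{N}$. A pure embedding $f:G\to H$ is an injective homomorphism whose image is a pure subgroup of $H$. A universal abelian $p$-group for purity of cardinality $\lambda$ is an abelian $p$-group $U_\lambda$ of cardinality $\lambda$ such that every abelian $p$-group of cardinality $\leq\lambda$ purely embeds in $U_\lambda$. *)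

(* Defs.v *)
From HB Require Import structures.
From mathcomp Require Import all_boot all_order all_algebra.
From mathcomp Require Import boolp classical_sets functions cardinality.

Set Implicit Arguments.
Unset Strict Implicit.
Unset Printing Implicit Defensive.

Import GRing.Theory.

Local Open Scope classical_set_scope.
Local Open Scope ring_scope.
Local Open Scope card_scope.

(* The cardinal of a type T is handled as the card_eq-class of [set: T]. *)
Definition card_lt (A B : Type) : bool :=
  ([set: A] #<= [set: B]) && ~~ ([set: B] #<= [set: A]).

(* is_aleph n T: the cardinal of T is aleph_n, where aleph_0 is the cardinal
   of nat and aleph_(n+1) is the least cardinal greater than aleph_n. *)
Fixpoint is_aleph (n : nat) (T : Type) : Prop :=
  if n is n'.+1 then
    exists S : Type, [/\ is_aleph n' S, card_lt S T &
      forall M : Type, card_lt S M -> [set: T] #<= [set: M]]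
  else [set: T] #= [set: nat].

Definition has_order (G : zmodType) (x : G) (k : nat) : Prop :=
  [/\ (0 < k)%N, x *+ k = 0 &
      forall m : nat, (0 < m)%N -> x *+ m = 0 -> (k <= m)%N].

Definition abelian_pgroup (p : nat) (G : zmodType) : Prop :=
  forall x : G, x != 0 -> exists n : nat, has_order x (p ^ n)%N.

Definition pure_subgroup (H : zmodType) (G : set H) : Prop :=
  zmod_closed (mem G) /\
  forall n : nat,
    [set h *+ n | h in [set: H]] `&` G = [set g *+ n | g in G].

Definition pure_embedding (G H : zmodType) (f : {additive G -> H}) : Prop :=
  injective f /\ pure_subgroup (range f).

Definition universal_pgroup (p : nat) (L : Type) (U : zmodType) : Prop :=
  [/\ abelian_pgroup p U, [set: U] #= [set: L] &
      forall G : zmodType, abelian_pgroup p G -> [set: G] #<= [set: L] ->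
        exists f : {additive G -> U}, pure_embedding f].

(* The remaining lemmas show that every aleph_n is the cardinal of some type,
   so that quantifying over the types satisfying is_aleph n is not vacuous. *)
Lemma card_leTP (A B : Type) :
  [set: A] #<= [set: B] <-> exists f : A -> B, injective f.
Proof.
split=> [/card_leP[f]|[f fI]].
  exists (fun a => val (f (to_setT a))) => x y /val_inj /inj.
  rewrite !inE => /(_ I I) => /(congr1 val) //.
apply: (card_le_trans _ (subset_card_le (@subsetT _ (range f)))).
have fE : range f #= [set: A] by exact: inj_card_eq (in2W fI).
by rewrite (card_le_eqr fE) card_lexx.
Qed.

Lemma card_min (I : Type) (A : I -> Type) : inhabited I ->
  exists i, forall j, [set: A i] #<= [set: A j].
Proof.
move=> [i0].
pose P (Z : set (forall i, A i)) :=
  forall z w i, Z z -> Z w -> z i = w i -> z = w.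
have [F FP Ftot|Z [ZP Zmax]] := @Zorn_bigcup _ P.
  move=> z w i [X FX Xz] [Y FY Yw] zw.
  by have [XY|YX] := Ftot X Y FX FY;
    [apply: (FP Y FY _ _ i) => //; exact: XY | apply: (FP X FX _ _ i) => //; exact: YX].
have [[i isurj]|nsurj] := pselect (exists i, forall a, exists2 z, Z z & z i = a).
  exists i => j; apply/card_leTP.
  have [g gP] : {g : A i -> forall j, A j & forall a, Z (g a) /\ g a i = a}.
    exists (fun a => sval (cid2 (isurj a))) => a.
    by case: (cid2 (isurj a)).
  exists (fun a => g a j) => a b gab.
  have [Za <-] := gP a; have [Zb <-] := gP b.
  by rewrite (ZP _ _ _ Za Zb gab).
have ex i : exists a : A i, forall z, Z z -> z i <> a.
  apply: contrapT => na; apply: nsurj; exists i => a.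
  apply: contrapT => nz; apply: na; exists a => z Zz za.
  by apply: nz; exists z.
pose w i := sval (cid (ex i)).
have wP i z : Z z -> z i <> w i by rewrite /w; case: (cid (ex i)) => /= a + Zz; apply.
case: (Zmax (Z `|` [set w])).
  split; first exact: subsetUl.
  by move=> /(_ w (or_intror erefl)) Zw; exact: (wP i0 _ Zw).
move=> z z' i [Zz|->] [Zz'|->] //; first exact: ZP.
- by move=> /(wP _ _ Zz).
- by move=> /esym /(wP _ _ Zz').
Qed.

Lemma card_le_totalT (A B : Type) :
  [set: A] #<= [set: B] \/ [set: B] #<= [set: A].
Proof.
have [|[] H] := @card_min bool (fun b => if b then A else B).
- by constructor; exact: true.
- by left; exact: (H false).
- by right; exact: (H true).
Qed.

Lemma is_aleph_exists (n : nat) : exists T : Type, is_aleph n T.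
Proof.
elim: n => [|n [S Sn]]; first by exists nat; exact: card_eqxx.
pose I := {X : set (set S) | ~ ([set: X] #<= [set: S])}.
have I0 : inhabited I.
  constructor; exists setT => /card_leTP[f fI].
  pose D : set S := [set s | exists2 X : set S, f (to_setT X) = s & ~ X s].
  have nDD : ~ D (f (to_setT D)).
    move=> DD; have [X fX nX] := DD; apply: nX.
    by have := congr1 val (fI _ _ fX) => /= ->.
  have DD : D (f (to_setT D)) by exists D.
  exact: nDD DD.
have [[X nX] Xmin] := @card_min I (fun X => sval X) I0.
exists X, S; split=> //.
  rewrite /card_lt; apply/andP; split; last exact/negP.
  by have [/nX|] := card_le_totalT X S.
move=> M /andP[_ /negP MS].
have [//|/card_leTP[f fI]] := card_le_totalT X M.
pose g m : set S := val (f m).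
have gI : injective g by move=> a b /val_inj /fI.
have MY : [set: M] #= [set: range g].
  rewrite (card_eqr (card_setT _)); apply: card_esym.
  exact: (inj_card_eq (A := setT) (in2W gI)).
have nY : ~ ([set: range g] #<= [set: S]) by rewrite -(card_le_eql MY).
have := Xmin (exist _ (range g) nY).
by rewrite /= -(card_le_eqr MY).
Qed.

(* Main.v *)
Require Import Defs.
From HB Require Import structures.
From mathcomp Require Import all_boot all_order all_algebra.
From mathcomp Require Import boolp classical_sets functions cardinality wochoice.
From Stdlib Require List.

(** Existence.  A p-group G has many homomorphisms into sums of copies of
    Z(p^oo) and of the groups Z/p^n, because these groups are divisible,
    respectively injective among groups of exponent p^n.  Homomorphisms r_n into
    sums of copies of Z/p^n with kernel p^n G, for all n > 0, detect divisibility
    by powers of p, and an injective homomorphism r_0 into a sum of copies of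
    Z(p^oo) detects the elements of infinite height.  Together they embed G
    purely into the torsion part of
      (sum of copies of Z(p^oo)) x prod_n (sum of copies of Z/p^n),
    where lambda copies are enough for G of size lambda; this group has size
    lambda^aleph_0.  The homomorphisms come from Zorn's lemma (hom_with_kernel).
    This settles the case lambda^aleph_0 = lambda.  If mu^aleph_0 < lambda for all
    mu < lambda, then either every sequence in lambda is bounded, and
    lambda^aleph_0 = lambda again, or lambda is a union of countably many smaller
    sets Q i.  In the second case G is the union of the subgroups Gs i generated
    by the parts of G indexed by the Q i, and the sum over i of the groups above
    for |Q i|^aleph_0 many copies has size lambda.  The i-th component is defined
    on all of G and kills Gs i; since its kernels on Gs (i+1) are controlled,
    injectivity and purity follow by induction on i (universal_embedding).

    For aleph_n >= 2^aleph_0, Hausdorff's formula gives aleph_n^aleph_0 = aleph_n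
    (aleph_power).

    Non-existence.  This is the argument of Kojman and Shelah.  Let n >= 2,
    lambda = aleph_n < 2^aleph_0, and number the elements of U by lambda.  For u
    in U and an increasing sequence a in lambda, consider the set of all m such
    that u is not congruent modulo p^(m+1) to an element of number below a m.
    Only lambda many subsets of nat arise from lambda many sequences a and the
    elements u of U, so some A does not.  On the other hand, for each given list of lambda many sequences
    there is a p-group of size lambda with elements x_d that give A along the d-th
    sequence, and a pure embedding into U preserves the invariant along all
    sequences inside a club of lambda.  The sequences are therefore taken from a
    club guessing family, which Shelah's theorem provides because lambda is
    regular and greater than aleph_1 (club_guessing). *)

Set Implicit Arguments.
Unset Strict Implicit.
Unset Printing Implicit Defensive.

Import Order.TTheory GRing.Theory Num.Theory.

(** * Comparison of cardinals through injections *)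

Definition embeds (A B : Type) : Prop := exists f : A -> B, injective f.

Lemma card_le_embeds (A B : Type) : ([set: A] #<= [set: B])%card <-> embeds A B.
Proof. exact: card_leTP. Qed.

Lemma embeds_refl A : embeds A A.
Proof. by exists id. Qed.

Lemma embeds_trans B A C : embeds A B -> embeds B C -> embeds A C.
Proof. by move=> [f fI] [g gI]; exists (g \o f); exact: inj_comp. Qed.

Lemma embeds_total A B : embeds A B \/ embeds B A.
Proof. by case: (card_le_totalT A B) => /card_le_embeds; [left | right]. Qed.

Lemma not_embeds A B : ~ embeds A B -> embeds B A.
Proof. by case: (embeds_total A B). Qed.

Lemma card_lt_embeds A B : card_lt A B <-> ~ embeds B A.
Proof.
rewrite /card_lt; split => [/andP[_ /negP BA] /card_le_embeds //|nBA].
by apply/andP; split; [apply/card_le_embeds/not_embeds |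
  apply/negP => /card_le_embeds].
Qed.

Lemma card_eq_embeds A B :
  ([set: A] #= [set: B])%card <-> embeds A B /\ embeds B A.
Proof.
rewrite card_eq_le; split; first by case/andP => /card_le_embeds ? /card_le_embeds.
by case=> AB BA; apply/andP; split; exact/card_le_embeds.
Qed.

Lemma sval_inj A (P : A -> Prop) : injective (@sval A P).
Proof. by move=> [x Px] [y Py] /= xy; exact: eq_exist. Qed.

Lemma embeds_sig A (P : A -> Prop) : embeds {x | P x} A.
Proof. by exists sval; exact: sval_inj. Qed.

Lemma embeds_rel A B (R : A -> B -> Prop) :
  (forall a, exists b, R a b) -> (forall a a' b, R a b -> R a' b -> a = a') ->
  embeds A B.
Proof.
move=> /choice[f fP] RI; exists f => a a' faa'.
by apply: (RI _ _ (f a)); rewrite // faa'.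
Qed.

Lemma embeds_surj A B (g : B -> A) : (forall a, exists b, g b = a) -> embeds A B.
Proof. by move=> gs; apply: (embeds_rel gs) => a a' b <- <-. Qed.

Lemma embeds_sigS A (P Q : A -> Prop) :
  (forall x, P x -> Q x) -> embeds {x | P x} {x | Q x}.
Proof.
move=> PQ; exists (fun x => exist Q (sval x) (PQ _ (proj2_sig x))).
by move=> x y /(congr1 sval) /= /sval_inj.
Qed.

Lemma embeds_prod A A' B B' : embeds A A' -> embeds B B' -> embeds (A * B) (A' * B').
Proof.
move=> [f fI] [g gI]; exists (fun x => (f x.1, g x.2)).
by move=> [a b] [a' b'] /= [/fI-> /gI->].
Qed.

Lemma embeds_option A B : embeds A B -> embeds (option A) (option B).
Proof. by move=> [f fI]; exists (omap f) => -[x|] [y|] //= [/fI->]. Qed.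

Lemma embeds_fun I A B : embeds A B -> embeds (I -> A) (I -> B).
Proof.
move=> [f fI]; exists (fun g => f \o g) => g h gh.
by apply/funext => i; apply: fI; exact: (congr1 (@^~ i) gh).
Qed.

(** The additional point goes off the diagonal. *)
Lemma embeds_option_square A (a b : A) : a <> b -> embeds (option A) (A * A).
Proof.
move=> ab; exists (fun x => if x is Some y then (y, y) else (a, b)).
by move=> [x|] [y|] //= [] // => [-> //|xa xb|ax bx]; case: ab; rewrite -?xa -?xb -?ax // bx.
Qed.

Lemma embeds_square_seq A : embeds (A * A) (nat -> A).
Proof.
exists (fun x n => if n is 0 then x.1 else x.2) => -[a b] [a' b'] /= e.
by have /= -> := congr1 (@^~ 0) e; have /= -> := congr1 (@^~ 1) e.
Qed.

Lemma embeds_seq_seq A : embeds (nat -> nat -> A) (nat -> A).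
Proof.
exists (fun f n => if unpickle n is Some (i, j) then f i j else f 0 0) => f g fg.
apply/funext => i; apply/funext => j.
by have := congr1 (@^~ (pickle (i, j))) fg; rewrite /= pickleK.
Qed.

Lemma embeds_nat_prod_seq A (a b : A) : a <> b -> embeds (nat * A) (nat -> A).
Proof.
move=> ab; exists (fun x m => if m is m'.+1 then if m' == x.1 then a else b else x.2).
move=> [n x] [m y] e; have /= -> := congr1 (@^~ 0) e.
have /= := congr1 (@^~ n.+1) e; rewrite eqxx.
by case: eqP => [-> //|_ /ab].
Qed.

Lemma embeds_list_seq A (a b : A) : a <> b -> embeds (seq A) (nat -> A).
Proof.
move=> ab; apply: (@embeds_trans (nat * (nat -> A))).
  exists (fun s => (size s, fun i => nth a s i)) => s t [st e].
  by apply: (@eq_from_nth _ a) => // i _; exact: (congr1 (@^~ i) e).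
apply: (@embeds_trans (nat -> nat -> A)); last exact: embeds_seq_seq.
apply: embeds_nat_prod_seq (fun=> a) (fun=> b) _ => e.
by apply: ab; exact: (congr1 (@^~ 0) e).
Qed.

(** A list is coded by its length together with its iterated pairing. *)
Lemma embeds_list A : embeds nat A -> embeds (A * A) A -> embeds (seq A) A.
Proof.
move=> [e eI] [f fI].
pose code := foldr (fun x c => f (x, c)) (e 0).
have codeI s t : size s = size t -> code s = code t -> s = t.
  elim: s t => [|x s IH] [|y t] //= [/IH st] /fI[-> /st ->] //.
exists (fun s => f (e (size s), code s)) => s t /fI[/eI st]; exact: codeI.
Qed.

Lemma infinite_embeds A : infinite_set [set: A] -> embeds nat A.
Proof. by move=> /infiniteP/card_le_embeds. Qed.

(** * Well-orders *)

Record strict_wo (T : Type) (lt : T -> T -> Prop) : Prop := StrictWo {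
  wo_wf : well_founded lt;
  wo_trans : forall x y z, lt x y -> lt y z -> lt x z;
  wo_total : forall x y, [\/ lt x y, x = y | lt y x] }.

Section WellOrder.
Variables (T : Type) (lt : T -> T -> Prop) (wo : strict_wo lt).

Lemma wo_irr x : ~ lt x x.
Proof. by elim: (wo_wf wo x) => y _ IH yy; exact: (IH y). Qed.

Lemma wo_asym x y : lt x y -> ~ lt y x.
Proof. by move=> xy yx; apply: (@wo_irr x); exact: wo_trans xy yx. Qed.

Lemma wo_le_lt x y z : ~ lt y x -> lt y z -> lt x z.
Proof. by case: (wo_total wo x y) => [xy _|-> //|//]; exact: wo_trans. Qed.

Lemma wo_lt_le x y z : lt x y -> ~ lt z y -> lt x z.
Proof. by case: (wo_total wo y z) => [yz xy _|<- //|//]; exact: wo_trans yz. Qed.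

Lemma wo_le_trans x y z : ~ lt y x -> ~ lt z y -> ~ lt z x.
Proof. by move=> yx zy zx; apply: zy; exact: wo_lt_le zx yx. Qed.

Lemma wo_anti x y : ~ lt x y -> ~ lt y x -> x = y.
Proof. by case: (wo_total wo x y). Qed.

Lemma wo_min (P : T -> Prop) : (exists x, P x) ->
  exists2 m, P m & forall y, P y -> ~ lt y m.
Proof.
move=> [x Px]; apply: contrapT => nomin.
elim: (wo_wf wo x) Px => y _ IH Py; apply: nomin; exists y => // z Pz zy.
exact: (IH z).
Qed.

(** Transfinite recursion for constructions that only specify which values are
    admissible at x, given the restriction g to the predecessors of x. *)
Lemma wf_choice (Y : Type) (P : forall x, (forall y, lt y x -> Y) -> Y -> Prop) :
  (forall x g, exists y, P x g y) ->
  exists f : T -> Y, forall x, P x (fun z _ => f z) (f x).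
Proof.
move=> exP.
have /choice[step stepP] : forall xg : {x & forall y, lt y x -> Y},
    exists y, P (projT1 xg) (projT2 xg) y by move=> [x g]; exact: exP.
pose F x g := step (existT _ x g).
exists (Fix (wo_wf wo) (fun=> Y) F) => x.
rewrite [X in P _ _ X]Fix_eq; first exact: (stepP (existT _ x _)).
move=> {}x f g fg; congr (F x _).
by apply/functional_extensionality_dep => y; apply/funext => yx; exact: fg.
Qed.

End WellOrder.

Lemma wo_preimage S T (lt : T -> T -> Prop) (f : S -> T) : injective f ->
  strict_wo lt -> strict_wo (fun x y => lt (f x) (f y)).
Proof.
move=> fI wo; split=> [x|x y z|x y]; last 2 first.
- exact: wo_trans.
- by case: (wo_total wo (f x) (f y)) => [?|/fI ?|?]; [apply: Or31|apply: Or32|apply: Or33].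
have := erefl (f x); move: {2}(f x) => t.
elim: (wo_wf wo t) x => {}t _ IH x fx; apply: Acc_intro => y yx.
by apply: (IH (f y)); rewrite // -fx.
Qed.

Lemma wo_nat : strict_wo (fun m n : nat => m < n).
Proof.
split=> [|x y z|x y]; last 2 first.
- exact: ltn_trans.
- by case: (ltngtP x y) => ?; [apply: Or31|apply: Or33|apply: Or32].
elim/ltn_ind => n IH; exact: Acc_intro.
Qed.

Lemma zermelo T : exists lt : T -> T -> Prop, strict_wo lt.
Proof.
have [R wR] := well_ordering_principle {classic T}.
have wC : wo_chain R predT by move=> A _; exact: wR.
have Rtot x y : R x y \/ R y x by apply/orP; exact: (wo_chainW wC).
have Ranti x y : R x y -> R y x -> x = y.
  by move=> xy yx; apply: (wo_chain_antisymmetric wC) => //; rewrite xy yx.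
have Rmin (P : T -> Prop) x : P x -> exists2 m, P m & forall y, P y -> R m y.
  move=> Px; have [|m [[Pm lm] _]] := wR (fun x => `[< P x >]).
    by exists x; apply/asboolP.
  exists m; first exact/asboolP.
  by move=> y Py; apply: lm; apply/asboolP.
exists (fun x y => R x y /\ x <> y); split=> [x|x y z [xy nxy] [yz nyz]|x y].
- apply: contrapT => /(Rmin (fun x => ~ Acc _ x))[m nm mP]; apply: nm.
  apply: Acc_intro => y [ym nym]; apply: contrapT => /mP my.
  by apply: nym; exact: Ranti.
- have [m mP ml] := Rmin (fun t => [\/ t = x, t = y | t = z]) _ (Or31 _ _ erefl).
  have xz : x <> z by move=> e; subst z; apply: nxy; exact: Ranti.
  split=> //; case: mP => e; subst m.
  + by apply: ml; apply: Or33.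
  + by case: nxy; apply: Ranti => //; apply: ml; exact: Or31.
  + by case: nyz; apply: Ranti => //; apply: ml; exact: Or32.
- have [->|nxy] := pselect (x = y); first exact: Or32.
  by case: (Rtot x y) => ?; [apply: Or31|apply: Or33; split=> // /esym].
Qed.

(** Take the least segment of an arbitrary well-order into which L embeds, and
    pull the order back along this embedding. *)
Lemma initial_wo L : exists lt : L -> L -> Prop,
  strict_wo lt /\ forall x, ~ embeds L {y | lt y x}.
Proof.
have [lt wo] := zermelo L.
have [[x0 Lx0]|noseg] := pselect (exists x, embeds L {y | lt y x}); last first.
  by exists lt; split=> // x Lx; apply: noseg; exists x.
have [x [f fI] xmin] := wo_min wo (ex_intro (fun x => embeds L {y | lt y x}) x0 Lx0).
pose g y := sval (f y); have gI : injective g by move=> a b /sval_inj/fI.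
exists (fun a b => lt (g a) (g b)); split; first exact: wo_preimage.
move=> a La; apply: (xmin (g a)); last exact: (proj2_sig (f a)).
apply: embeds_trans La _.
exists (fun y => exist (fun t => lt t (g a)) (g (sval y)) (proj2_sig y)).
by move=> y z /(congr1 sval)/gI/sval_inj.
Qed.

(** An injection chosen greedily along a well-order of X fails to exist only if
    at some stage the values already taken exhaust Y.  The well-order used is
    lexicographic: first by the rank, then by an arbitrary well-order of X. *)
Lemma embeds_ranked X Y B (lt : B -> B -> Prop) (rk : X -> B) : strict_wo lt ->
  (forall b, ~ embeds Y {x | ~ lt b (rk x)}) -> embeds X Y.
Proof.
move=> wo small; have [ltX woX] := zermelo X.
pose lex x y := lt (rk x) (rk y) \/ rk x = rk y /\ ltX x y.
have lexwo : strict_wo lex.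
  split=> [x|x y z|x y].
  - have := erefl (rk x); move: {2}(rk x) => b.
    elim: (wo_wf wo b) x => {}b _ IHb x.
    elim: (wo_wf woX x) => {}x _ IHx bx; apply: Acc_intro => y [yx|[yx xy]].
      by apply: (IHb (rk y)); rewrite // -bx.
    by apply: IHx; rewrite // yx.
  - move=> [xy|[xy xy']] [yz|[yz yz']].
    + by left; exact: wo_trans xy yz.
    + by left; rewrite -yz.
    + by left; rewrite xy.
    + by right; rewrite xy yz; split=> //; exact: wo_trans xy' yz'.
  - case: (wo_total wo (rk x) (rk y)) => [?|e|?].
    + by apply: Or31; left.
    + case: (wo_total woX x y) => [?|->|?].
      * by apply: Or31; right.
      * exact: Or32.
      * by apply: Or33; right.
    + by apply: Or33; left.
have free x (g : forall z, lex z x -> Y) : exists y, forall z zx, g z zx <> y.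
  apply: contrapT => nofree; apply: (small (rk x)).
  apply: (embeds_rel (R := fun y z => exists zx, g (sval z) zx = y)); last first.
    by move=> y y' z [zx <-] [zx' <-]; congr g; exact: Prop_irrelevance.
  move=> y; have [z [zx gz]] : exists z (zx : lex z x), g z zx = y.
    apply: contrapT => n; apply: nofree; exists y => z zx gz; apply: n.
    by exists z, zx.
  have zx' : ~ lt (rk x) (rk z).
    by case: zx {gz} => [|[-> _]]; [exact: wo_asym|exact: wo_irr].
  by exists (exist _ z zx'); exists zx.
have [f fP] := wf_choice lexwo free.
exists f => x y fxy; case: (wo_total lexwo x y) => // l.
- by case: (fP y x l).
- by case: (fP x y l).
Qed.

(** * Cofinality, the alephs and countable powers *)

Definition bounded L (lt : L -> L -> Prop) (S : Type) : Prop :=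
  forall f : S -> L, exists b, forall s, lt (f s) b.

Lemma boundedS L (lt : L -> L -> Prop) (l0 : L) S T :
  embeds T S -> bounded lt S -> bounded lt T.
Proof.
move=> [i iI] bS f.
have [b bP] := bS (fun s => if pselect (exists t, i t = s) is left e
  then f (sval (cid e)) else l0).
exists b => t; have := bP (i t); case: pselect => [e|[]]; last by exists t.
by case: cid => t' /= /iI ->.
Qed.

Lemma embeds_closed_segment L (lt : L -> L -> Prop) x : strict_wo lt ->
  embeds {y | ~ lt x y} (option {y | lt y x}).
Proof.
move=> wo; pose R (y : {y | ~ lt x y}) (o : option {y | lt y x}) := sval y = oapp sval x o.
apply: (embeds_rel (R := R)) => [[y xy]|y y' o]; last first.
  by rewrite /R => yo y'o; apply: sval_inj; rewrite yo y'o.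
case: (wo_total wo x y) => [/xy //|xey|yx]; last by exists (Some (exist _ y yx)).
by exists None; rewrite /R /= xey.
Qed.

(** An unbounded f : S -> L would make L a union of S many closed segments, each
    of size at most S. *)
Lemma regular_bounded L (lt : L -> L -> Prop) S : strict_wo lt ->
  embeds (S * S) S -> ~ embeds L S -> (forall x, embeds {y | ~ lt x y} S) ->
  bounded lt S.
Proof.
move=> wo SS LS seg f; apply: contrapT => unb; apply: LS.
apply: embeds_trans SS; pose h x := sval (cid (seg x)); have hI x : injective (h x) := svalP (cid (seg x)).
pose R b q := exists H : ~ lt (f q.1) b, h (f q.1) (exist _ b H) = q.2.
apply: (embeds_rel (R := R)) => [b|b b' [s c] [/= H <-] [H' /hI]]; last first.
  by move=> /(congr1 sval).
have [s sb] : exists s, ~ lt (f s) b.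
  by apply: contrapT => n; apply: unb; exists b => s; apply: contrapT => ?; apply: n; exists s.
by exists (s, h (f s) (exist _ b sb)); exists sb.
Qed.

(** Rank a sequence by a strict bound of its values. *)
Lemma embeds_power_bounded L (lt : L -> L -> Prop) : strict_wo lt ->
  bounded lt nat -> (forall b, ~ embeds L (nat -> {y | ~ lt b y})) ->
  embeds (nat -> L) L.
Proof.
move=> wo /choice[rk rkP] small.
apply: (embeds_ranked (rk := rk) wo) => b Lb; apply: (small b).
apply: embeds_trans Lb _.
have below (f : {f | ~ lt b (rk f)}) n : ~ lt b (sval f n).
  by move=> bf; apply: (proj2_sig f); exact: wo_trans bf (rkP _ n).
exists (fun f n => exist (fun y => ~ lt b y) (sval f n) (below f n)) => f g fg.
by apply/sval_inj/funext => n; exact: (congr1 (fun h => sval (h n)) fg).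
Qed.

Lemma embeds_nat_square : embeds (nat * nat) nat.
Proof. by exists pickle; exact: pcan_inj pickleK. Qed.

(** A segment of an initial well-order of L is smaller than L, the least cardinal
    above S, so it embeds into S.  The arithmetic of aleph_n is a hypothesis
    because this lemma serves to prove it by induction on n. *)
Lemma aleph_succ_wo n L : is_aleph n.+1 L -> (forall S, is_aleph n S ->
    embeds nat S /\ embeds (S * S) S) ->
  exists S (lt : L -> L -> Prop), [/\ is_aleph n S, strict_wo lt,
    embeds S L, ~ embeds L S & forall x, embeds {y | ~ lt x y} S].
Proof.
move=> [S [Sn /card_lt_embeds LS Lmin]] sq; have [nS SS] := sq S Sn.
have [lt [wo seg]] := initial_wo L; exists S, lt; split=> //.
  exact: not_embeds.
move=> x; apply: embeds_trans (embeds_closed_segment x wo) _.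
have [e eI] := nS.
apply: (@embeds_trans (option S)); last first.
  apply: embeds_trans SS; apply: (@embeds_option_square _ (e 0) (e 1)).
  by move=> /eI.
apply: embeds_option; apply: contrapT => xS; apply: (seg x).
by apply/card_le_embeds; apply: Lmin; apply/card_lt_embeds.
Qed.

(** For the successor step, rank a pair by its maximum: the pairs of rank at most
    b lie in the square of a closed segment, hence are no more than aleph_n. *)
Lemma aleph_square n L : is_aleph n L -> embeds nat L /\ embeds (L * L) L.
Proof.
elim: n L => [|n IH] L.
  move=> /card_eq_embeds[Ln nL]; split=> //.
  by apply: embeds_trans (embeds_prod Ln Ln) (embeds_trans embeds_nat_square nL).
move=> Ln; have [S [lt [Sn wo SL LS seg]]] := aleph_succ_wo Ln IH.
have [nS SS] := IH S Sn; split; first exact: embeds_trans nS SL.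
pose rk (q : L * L) := if `[< lt q.1 q.2 >] then q.2 else q.1.
apply: (embeds_ranked (rk := rk) wo) => b Lb; apply: LS.
apply: embeds_trans Lb (embeds_trans _ SS).
apply: embeds_trans (embeds_prod (seg b) (seg b)).
have bq (q : {q | ~ lt b (rk q)}) : ~ lt b (sval q).1 /\ ~ lt b (sval q).2.
  case: q => -[x y]; rewrite /rk /=; case: asboolP => xy nb; split=> // bx; apply: nb.
    exact: wo_trans bx xy.
  exact: wo_lt_le bx xy.
exists (fun q => (exist (fun y => ~ lt b y) _ (bq q).1,
                  exist (fun y => ~ lt b y) _ (bq q).2)) => q q' e.
have e1 := congr1 (fun z => sval z.1) e; have e2 := congr1 (fun z => sval z.2) e.
move: e1 e2 => /= e1 e2; apply: sval_inj.
by move: e1 e2; case: (sval q) => a b'; case: (sval q') => c d /= -> ->.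
Qed.

Lemma aleph_succ_regular n L : is_aleph n.+1 L ->
  exists S (lt : L -> L -> Prop), [/\ is_aleph n S, strict_wo lt,
    ~ embeds L S, bounded lt S & forall x, embeds {y | ~ lt x y} S].
Proof.
move=> Ln; have [S [lt [Sn wo SL LS seg]]] := aleph_succ_wo Ln (@aleph_square n).
exists S, lt; split=> //; apply: (regular_bounded wo) => //.
by have [] := aleph_square Sn.
Qed.

Lemma aleph1_below n S : is_aleph n.+1 S ->
  exists W, is_aleph 1 W /\ embeds W S.
Proof.
elim: n S => [|n IH] S; first by exists S; split=> //; exact: embeds_refl.
move=> Sn; have [S' [lt [S'n wo S'S _ _]]] := aleph_succ_wo Sn (@aleph_square n.+1).
by have [W [W1 WS]] := IH _ S'n; exists W; split=> //; exact: embeds_trans WS S'S.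
Qed.

Lemma cantor_nat : ~ embeds (nat -> bool) nat.
Proof.
move=> [f fI]; pose d n := ~~ `[< exists2 g, f g = n & g n >].
have : d (f d) = ~~ d (f d).
  rewrite {1}/d; congr negb; apply/asboolP/idP => [[g /fI -> //]|dd].
  by exists d.
by case: (d (f d)).
Qed.

Lemma aleph_unique n S S' : is_aleph n S -> is_aleph n S' -> embeds S S'.
Proof.
elim: n S S' => [|n IH] S S'.
  move=> /card_eq_embeds[Sn _] /card_eq_embeds[_ nS']; exact: embeds_trans Sn nS'.
move=> [R [Rn _ Smin]] [R' [R'n /card_lt_embeds S'R' _]].
apply/card_le_embeds; apply: Smin; apply/card_lt_embeds => S'R.
by apply: S'R'; apply: embeds_trans S'R (IH _ _ Rn R'n).
Qed.

(** Hausdorff's formula: a countable subset of aleph_(n+1) is bounded, so the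
    countable powers of the initial segments already exhaust the power. *)
Lemma aleph_power n L : is_aleph n L -> embeds (nat -> bool) L ->
  embeds (nat -> L) L.
Proof.
elim: n L => [|n IH] L.
  by move=> /card_eq_embeds[Ln _] /embeds_trans/(_ Ln)/cantor_nat.
move=> Ln cL; have [S [lt [Sn wo LS bS seg]]] := aleph_succ_regular Ln.
have [nS SS] := aleph_square Sn.
have [cS|ncS] := pselect (embeds (nat -> bool) S).
  apply: (embeds_power_bounded wo) => [|b Lb].
    have [[e _] _] := aleph_square Ln; exact: boundedS (e 0) _ _ nS bS.
  apply: LS; apply: embeds_trans Lb _.
  exact: embeds_trans (embeds_fun _ (seg b)) (IH _ Sn cS).
have Lc : embeds L (nat -> bool).
  case: Ln => S' [S'n S'L Lmin]; apply/card_le_embeds; apply: Lmin; apply/card_lt_embeds => cS'.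
  by apply: ncS; exact: embeds_trans cS' (aleph_unique S'n Sn).
apply: embeds_trans (embeds_fun _ Lc) (embeds_trans (embeds_seq_seq _) cL).
Qed.

(** Distinguish whether all sequences in an initial well-order of L are bounded.
    If not, the closed segments at the terms of a cofinal sequence cover L.  The
    hypothesis bounds the countable powers of open segments; for closed ones, two
    elements below x absorb x into such a power. *)
Lemma power_or_filtration L : embeds nat L ->
  (forall M, ~ embeds L M -> ~ embeds L (nat -> M)) ->
  embeds (nat -> L) L \/
  exists (Q : nat -> L -> Prop) (a b : L), [/\ a <> b, Q 0 a, Q 0 b,
    (forall m n x, m <= n -> Q m x -> Q n x) /\ (forall x, exists n, Q n x) &
    forall n, ~ embeds L (nat -> {x | Q n x})].
Proof.
move=> [e eI] small; have [lt [wo seg]] := initial_wo L.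
have [a _ amin] := wo_min wo (ex_intro (fun=> True) (e 0) I).
have [b ba bmin] : exists2 b, b <> a & forall y, y <> a -> ~ lt y b.
  apply: (wo_min wo); apply: contrapT => n.
  have all x : x = a by apply: contrapT => xa; apply: n; exists x.
  by have /eI : e 0 = e 1 by rewrite (all (e 0)) (all (e 1)).
have [c [ca cb] cmin] : exists2 c, c <> a /\ c <> b &
    forall y, y <> a /\ y <> b -> ~ lt y c.
  apply: (wo_min wo); apply: contrapT => n.
  have all x : x = a \/ x = b.
    by apply: contrapT => /not_orP xab; apply: n; exists x.
  have e01 : e 0 <> e 1 by move=> /eI.
  have e02 : e 0 <> e 2 by move=> /eI.
  have e12 : e 1 <> e 2 by move=> /eI.
  by case: (all (e 0)) (all (e 1)) (all (e 2)) => [] h0 [] h1 [] h2; congruence.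
have ab : lt a b.
  by case: (wo_total wo a b) => // [/esym //|/amin]; case.
have bc : lt b c.
  case: (wo_total wo b c) => // [/esym //|/bmin]; case.
  exact: ca.
have closed x : ~ lt x c -> ~ embeds L (nat -> {y | ~ lt x y}).
  move=> cx Lx; apply: (small _ (seg x)).
  apply: embeds_trans Lx (embeds_trans _ (embeds_seq_seq _)).
  apply: embeds_fun; apply: embeds_trans (embeds_closed_segment x wo) _.
  apply: embeds_trans (embeds_square_seq _).
  have bx : lt b x by exact: wo_lt_le bc cx.
  have ax : lt a x by exact: wo_trans ab bx.
  by apply: (@embeds_option_square _ (exist _ a ax) (exist _ b bx)) => /(congr1 sval)/esym.
have [bnat|unb] := pselect (bounded lt nat).
  left; apply: (embeds_power_bounded wo bnat) => x Lx.
  have [xc|xc] := pselect (lt x c); last exact: closed xc Lx.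
  apply: (closed c (@wo_irr _ _ wo c)); apply: embeds_trans Lx _.
  by apply/embeds_fun/embeds_sigS => y xy cy; apply: xy; exact: wo_trans xc cy.
right; have [f fP] : exists f : nat -> L, forall x, exists n, ~ lt (f n) x.
  apply: contrapT => n; apply: unb => f; apply: contrapT => nb; apply: n; exists f => x.
  apply: contrapT => nx; apply: nb; exists x => m; apply: contrapT => ?.
  by apply: nx; exists m.
pose g := fix g n := if n is m.+1 then
  if `[< lt (g m) (f m) >] then f m else g m else c.
have gS n : ~ lt (g n.+1) (g n) /\ ~ lt (g n.+1) (f n).
  rewrite /=; case: asboolP => l; split=> //; [exact: wo_asym|exact: wo_irr|exact: wo_irr].
have gle m n : m <= n -> ~ lt (g n) (g m).
  elim: n => [|n IH]; first by rewrite leqn0 => /eqP ->; exact: wo_irr.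
  rewrite leq_eqVlt => /predU1P[->|/IH mn]; first exact: wo_irr.
  exact: wo_le_trans mn (gS n).1.
exists (fun n x => ~ lt (g n) x), a, b; split.
- by move=> e'; apply: ba.
- by move=> ca'; apply: (wo_asym wo ab); exact: (wo_trans wo bc ca').
- exact: wo_asym.
- split=> [m n x mn mx nx|x].
    by apply: mx; exact: wo_le_lt (gle _ _ mn) nx.
  have [n nx] := fP x; exists n.+1 => gx; apply: nx.
  exact: wo_le_lt (gS n).2 gx.
- by move=> n; apply: closed; exact: (gle 0 n).
Qed.

(** * Club guessing *)

Section ClubGuessing.
Variables (L : Type) (lt : L -> L -> Prop) (wo : strict_wo lt).
Hypothesis bounded_nat : bounded lt nat.
Hypothesis bounded_segment : forall x, bounded lt {y | ~ lt x y}.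

Definition closed_under (F : L -> L) (a : L) : Prop := forall b, lt b a -> lt (F b) a.

Lemma closed_underS F F' a : (forall b, ~ lt (F' b) (F b)) ->
  closed_under F' a -> closed_under F a.
Proof. by move=> FF' cl b ba; exact: (wo_le_lt wo (FF' b) (cl b ba)). Qed.

Lemma wo_max2 x y : exists z, ~ lt z x /\ ~ lt z y.
Proof.
have [xy|xy] := pselect (lt x y); [exists y|exists x]; split=> //.
- exact: wo_asym.
- exact: wo_irr.
- exact: wo_irr.
Qed.

Lemma least_strict_bound (f : nat -> L) : exists2 d,
  forall n, lt (f n) d & forall x, lt x d -> exists n, ~ lt (f n) x.
Proof.
have [d dP dmin] := wo_min wo (bounded_nat f).
exists d => // x xd; apply: contrapT => n; apply: (dmin x) xd => m.
by apply: contrapT => fx; apply: n; exists m.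
Qed.

(** The supremum of x, F x, F (F x) and so on, with F made monotone. *)
Lemma closed_under_unbounded F x : exists2 e, lt x e & closed_under F e.
Proof.
have /choice[nxt nxtP] : forall y, exists z, lt y z /\
    forall b, ~ lt y b -> lt (F b) z.
  move=> y.
  have [z1 z1P] := bounded_segment (fun s : {b | ~ lt y b} => F (sval s)).
  have [z2 z2P] := bounded_segment (fun s : {b | ~ lt y b} => sval s).
  have [z [zz1 zz2]] := wo_max2 z1 z2; exists z; split.
    exact: (wo_lt_le wo (z2P (exist _ y (@wo_irr _ _ wo y))) zz2).
  by move=> b yb; exact: (wo_lt_le wo (z1P (exist _ b yb)) zz1).
have [e eP emin] := least_strict_bound (fun n => iter n nxt x).
exists e; first exact: (eP 0).
move=> b /emin[n nb]; apply: (wo_trans wo) (eP n.+1) => /=.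
exact: (nxtP _).2.
Qed.

(** The closure points of F form a closed set, so there is a largest one below a;
    it is found as the least upper bound of those below a. *)
Lemma closed_under_floor F a : exists e, [/\ closed_under F e, ~ lt a e &
  forall e', closed_under F e' -> ~ lt a e' -> ~ lt e e'].
Proof.
pose P b := forall e', closed_under F e' -> ~ lt a e' -> ~ lt b e'.
have [|e eP emin] := @wo_min _ _ wo P; first by exists a.
exists e; split=> //; last exact: emin.
move=> b be; have [e' [ce' ae' be']] :
    exists e', [/\ closed_under F e', ~ lt a e' & lt b e'].
  apply: contrapT => n; apply: (emin b) be => e' ce' ae' be'; apply: n.
  by exists e'.
exact: (wo_lt_le wo (ce' _ be') (eP _ ce' ae')).
Qed.

Lemma strictly_increasing_thinning (d : nat -> L) :
  (forall n, exists k, lt (d n) (d k)) ->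
  exists t : nat -> L, (forall j, lt (t j) (t j.+1)) /\ forall j, exists n, t j = d n.
Proof.
move=> /choice[g gP]; exists (fun j => d (iter j g 0)).
by split=> j; [exact: gP | exists (iter j g 0)].
Qed.

Variables (W : Type) (ltW : W -> W -> Prop) (woW : strict_wo ltW) (w0 : W).
Hypothesis boundedW_nat : bounded ltW nat.
Hypothesis bounded_W : bounded lt W.

Lemma pointwise_bound (f g : W -> L) : exists b, forall i, ~ lt b (f i) /\ ~ lt b (g i).
Proof.
have [b1 b1P] := bounded_W f; have [b2 b2P] := bounded_W g.
have [b [bb1 bb2]] := wo_max2 b1 b2; exists b => i; split.
  by apply: (wo_asym wo); exact: (wo_lt_le wo (b1P i)).
by apply: (wo_asym wo); exact: (wo_lt_le wo (b2P i)).
Qed.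

(** Shelah's argument.  Project a fixed family c0 of cofinal sequences onto the
    closure points of F.  If for every F there were an F' such that none of
    these sequences consisted of closure points of F', iterating F |-> F' along W would give a
    decreasing sequence of clubs.  Each term of a projected sequence only
    decreases along the iteration, hence stabilises; there are countably many
    terms, so all of them are stable from some index i on, and then the i-th
    family hits the next club. *)
Theorem club_guessing (l0 : L) : exists c : L -> nat -> L, forall F, exists d,
  (forall n, lt (c d n) (c d n.+1)) /\ forall n, closed_under F (c d n).
Proof.
pose cofinal (c : nat -> L) d := (forall n, lt (c n) d) /\
  forall x, lt x d -> exists n, lt x (c n).
have /choice[c0 c0P] : forall d, exists c0, forall c, cofinal c d -> cofinal c0 d.
  move=> d; have [[c cd]|n] := pselect (exists c, cofinal c d).
    by exists c.
  by exists (fun=> l0) => c cd; case: n; exists c.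
have /choice[fl flP] : forall F, exists f, forall a, [/\ closed_under F (f a),
    ~ lt a (f a) & forall e', closed_under F e' -> ~ lt a e' -> ~ lt (f a) e'].
  by move=> F; have [f fP] := choice (closed_under_floor F); exists f.
pose good (t d : nat -> L) := (forall j, lt (t j) (t j.+1)) /\ forall j, exists n, t j = d n.
have /choice[thin thinP] : forall d, exists t,
    (forall n, exists k, lt (d n) (d k)) -> good t d.
  move=> d; have [h|n] := pselect (forall n, exists k, lt (d n) (d k)).
    by have [t tP] := strictly_increasing_thinning h; exists t.
  by exists d.
apply: contrapT => noguess.
pose c F d := thin (fun n => fl F (c0 d n)).
have /choice[next nextP] : forall F, exists F', forall d,
    ~ ((forall n, lt (c F d n) (c F d n.+1)) /\
       forall n, closed_under F' (c F d n)).
  move=> F; apply: contrapT => n; apply: noguess; exists (c F) => F'.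
  by apply: contrapT => n'; apply: n; exists F' => d ?; apply: n'; exists d.
(* At stage i, dominate all earlier functions and their successors. *)
have step i (g : forall j, ltW j i -> L -> L) : exists F, forall j h b,
    ~ lt (F b) (g j h b) /\ ~ lt (F b) (next (g j h) b).
  suff /choice[F FP] : forall b, exists x, forall j h,
      ~ lt x (g j h b) /\ ~ lt x (next (g j h) b).
    by exists F => j h b; exact: FP.
  move=> b.
  have [x xP] := pointwise_bound
    (fun j => if pselect (ltW j i) is left h then g j h b else b)
    (fun j => if pselect (ltW j i) is left h then next (g j h) b else b).
  exists x => j h; have := xP j; case: pselect => // h'.
  by rewrite (Prop_irrelevance h' h).
have [Fs FsP] := wf_choice woW step.
have /choice[Foo FooP] : forall b, exists x, forall i, ~ lt x (Fs i b).
  move=> b; have [x xP] := pointwise_bound (Fs^~ b) (Fs^~ b).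
  by exists x => i; case: (xP i).
have fl_anti i j a : ltW j i -> ~ lt (fl (Fs j) a) (fl (Fs i) a).
  move=> ji; have [_ _] := flP (Fs j) a; apply; last by case: (flP (Fs i) a).
  apply: closed_underS (_ : closed_under (Fs i) _); last by case: (flP (Fs i) a).
  by move=> b; case: (FsP i j ji b).
(* Iterating u gives a sequence of points closed under every stage; d is its
   supremum. *)
have /choice[u uP] : forall x, exists y, lt x y /\ closed_under Foo y.
  by move=> x; have [e] := closed_under_unbounded Foo x; exists e.
pose e n := u (iter n u l0).
have eS n : lt (e n) (e n.+1) by exact: (uP _).1.
have [d ed dmin] := least_strict_bound e.
have [c0d c0cof] : cofinal (c0 d) d.
  apply: (c0P d e); split=> // x /dmin[n nx]; exists n.+1.
  exact: (wo_le_lt wo nx (eS n)).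
(* The n-th projected term has its least value at the stage stab n. *)
have /choice[stab stabP] : forall n, exists j, forall i,
    ~ lt (fl (Fs i) (c0 d n)) (fl (Fs j) (c0 d n)).
  move=> n.
  have [|_ [i ->] imin] := @wo_min _ _ wo (fun x => exists i, x = fl (Fs i) (c0 d n)).
    by exists (fl (Fs w0) (c0 d n)), w0.
  by exists i => j; apply: imin; exists j.
have [i iP] := boundedW_nat stab.
have [i' i'P] := boundedW_nat (fun=> i).
have ii' : ltW i i' := i'P 0.
have stable n : fl (Fs i') (c0 d n) = fl (Fs i) (c0 d n).
  apply: (wo_anti wo); last exact: fl_anti.
  apply: (wo_le_trans wo (y := fl (Fs (stab n)) (c0 d n))); last exact: stabP.
  exact: fl_anti.
have unbdd n : exists k, lt (fl (Fs i) (c0 d n)) (fl (Fs i) (c0 d k)).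
  have [m mn] : exists m, lt (c0 d n) (e m).
    have [m mn] := dmin _ (c0d n); exists m.+1.
    exact: (wo_le_lt wo mn (eS m)).
  have [k ek] := c0cof _ (ed m); exists k.
  have [_ _ /(_ (e m)) flk] := flP (Fs i) (c0 d k).
  have [_ cn _] := flP (Fs i) (c0 d n).
  apply: (wo_lt_le wo (_ : lt _ (e m)) (flk _ _)).
  - exact: (wo_le_lt wo cn mn).
  - by apply: closed_underS (_ : closed_under Foo _); [move=> b; exact: FooP|exact: (uP _).2].
  - exact: wo_asym.
have [tinc tval] := thinP _ unbdd.
apply: (nextP (Fs i) d); split=> // n.
rewrite /c; have [k ->] := tval n; rewrite -stable.
apply: closed_underS (_ : closed_under (Fs i') _); last by case: (flP (Fs i') (c0 d k)).
by move=> b; case: (FsP i' i ii' b).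
Qed.

End ClubGuessing.

Local Open Scope ring_scope.

(** * Subgroups as groups *)

Record subgroup (V : zmodType) : Type := Subgroup {
  in_subgroup :> V -> Prop;
  subgroup0 : in_subgroup 0;
  subgroupB : forall x y, in_subgroup x -> in_subgroup y -> in_subgroup (x - y) }.

Section SubgroupType.
Variables (V : zmodType) (S : subgroup V).

Lemma subgroupN x : S x -> S (- x).
Proof. by rewrite -sub0r; apply: subgroupB; exact: subgroup0. Qed.

Lemma subgroupD x y : S x -> S y -> S (x + y).
Proof. by move=> Sx Sy; rewrite -[y]opprK; apply: subgroupB => //; exact: subgroupN. Qed.

Lemma subgroupMn x n : S x -> S (x *+ n).
Proof.
move=> Sx; elim: n => [|n IH]; first by rewrite mulr0n; exact: subgroup0.
by rewrite mulrSr; exact: subgroupD.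
Qed.

Lemma subgroupMz x (z : int) : S x -> S (x *~ z).
Proof.
by case: z => n Sx; [exact: subgroupMn | apply: subgroupN; exact: subgroupMn].
Qed.

Definition subgroup_pred : {pred V} := fun x => `[< S x >].

Lemma subgroup_zmod_closed : zmod_closed subgroup_pred.
Proof.
split; first exact/asboolP/subgroup0.
by move=> x y /asboolP Sx /asboolP Sy; exact/asboolP/subgroupB.
Qed.

HB.instance Definition _ := GRing.isZmodClosed.Build V subgroup_pred subgroup_zmod_closed.

Record subgroup_type := SubgroupElt { sgval : V; _ : sgval \in subgroup_pred }.
HB.instance Definition _ := [isSub for sgval].
HB.instance Definition _ := [Choice of subgroup_type by <:].
HB.instance Definition _ := [SubChoice_isSubZmodule of subgroup_type by <:].

Lemma sgvalP (x : subgroup_type) : S (sgval x).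
Proof. by case: x => x /= /asboolP. Qed.

Lemma sgval_ex x : S x -> exists y : subgroup_type, sgval y = x.
Proof. by move=> /asboolP Sx; exists (SubgroupElt Sx). Qed.

Lemma sgval_inj : injective sgval.
Proof. exact: val_inj. Qed.

Lemma sgvalMn (x : subgroup_type) n : sgval (x *+ n) = sgval x *+ n.
Proof. exact: (raddfMn (val : {additive subgroup_type -> V})). Qed.

Lemma sgval0 : sgval 0 = 0.
Proof. exact: (raddf0 (val : {additive subgroup_type -> V})). Qed.

Lemma sgvalD x y : sgval (x + y) = sgval x + sgval y.
Proof. exact: (raddfD (val : {additive subgroup_type -> V})). Qed.

Lemma sgvalB x y : sgval (x - y) = sgval x - sgval y.
Proof. exact: (raddfB (val : {additive subgroup_type -> V})). Qed.

End SubgroupType.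

(** * The group of rationals modulo the integers *)

Lemma int_rat0 : (0 : rat) \is a Num.int.
Proof. exact: rpred0. Qed.

Lemma int_ratB (x y : rat) : x \is a Num.int -> y \is a Num.int -> x - y \is a Num.int.
Proof. exact: rpredB. Qed.

Definition int_rat : subgroup rat := @Subgroup rat (fun x => x \is a Num.int) int_rat0 int_ratB.

(** A single countable divisible group that contains Z(p^oo), as its p-torsion
    part, and each Z/p^n, as the set of elements killed by p^n. *)
Definition QZ : zmodType := Quotient.quot (subgroup_pred int_rat : zmodClosed rat).

Definition QZpi (x : rat) : QZ := (\pi_(Quotient.quot (subgroup_pred int_rat : zmodClosed rat)) x)%qT.

Lemma QZpiB x y : QZpi (x - y) = QZpi x - QZpi y.
Proof. by rewrite /QZpi raddfB. Qed.

Lemma QZpi_eq0 x : QZpi x = 0 <-> x \is a Num.int.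
Proof.
have -> : (0 : QZ) = QZpi 0 by rewrite -[0 in RHS](subrr 0) QZpiB subrr.
split=> [/eqP|xint].
  rewrite /QZpi -Quotient.idealrBE subr0; exact: asboolW.
apply/eqP; rewrite /QZpi -Quotient.idealrBE subr0; exact/asboolP.
Qed.

Lemma QZpiMn x n : QZpi (x *+ n) = QZpi x *+ n.
Proof. by rewrite /QZpi raddfMn. Qed.

Lemma QZpi_surj c : exists x, QZpi x = c.
Proof. by exists (repr c); rewrite /QZpi reprK. Qed.

Lemma QZ_divisible p c : (0 < p)%N -> exists d : QZ, d *+ p = c.
Proof.
move=> p0; have [x <-] := QZpi_surj c; exists (QZpi (x / p%:R)).
by rewrite -QZpiMn -[(_ / _) *+ _]mulr_natr divfK // pnatr_eq0 -lt0n.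
Qed.

Definition QZfrac p n : QZ := QZpi (p%:R ^- n).

Lemma QZfracS p n : (0 < p)%N -> QZfrac p n.+1 *+ p = QZfrac p n.
Proof.
move=> p0; rewrite /QZfrac -QZpiMn exprS invfM -[(_ * _) *+ _]mulr_natr mulrAC mulVf ?mul1r //.
by rewrite pnatr_eq0 -lt0n.
Qed.

Lemma QZfrac0 p : QZfrac p 0 = 0.
Proof. by apply/QZpi_eq0; rewrite expr0 invr1; exact: rpred1. Qed.

Lemma QZfrac_expn p n k : (0 < p)%N -> QZfrac p (n + k) *+ p ^ k = QZfrac p n.
Proof.
move=> p0; elim: k => [|k IH]; first by rewrite addn0.
by rewrite expnSr mulrnA -[LHS]mulrnA mulnC mulrnA addnS QZfracS.
Qed.

Lemma QZfrac1_neq0 p : (1 < p)%N -> QZfrac p 1 <> 0.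
Proof.
move=> p1 /QZpi_eq0 /intrP[m]; rewrite expr1 => pm.
have p0 : (p%:R : rat) != 0 by rewrite pnatr_eq0 -lt0n ltnW.
have : (p%:R * m%:~R : rat) = 1 by rewrite -pm mulfV.
rewrite -[p%:R]/(p%:Z%:~R) -intrM => /eqP; rewrite -[1]/(1%:~R) eqr_int.
by move=> /eqP/(congr1 absz); rewrite abszM /= => /eqP; rewrite muln_eq1 => /andP[/eqP pe _]; rewrite pe in p1.
Qed.

Lemma QZ_countable : embeds QZ nat.
Proof.
apply: (@embeds_trans rat); last by exists pickle; exact: pcan_inj pickleK.
exact: embeds_surj QZpi_surj.
Qed.

(** * p-groups and pure embeddings *)

Definition p_torsion p (G : zmodType) := forall x : G, exists k, x *+ p ^ k = 0.

(** The order of x divides each p^k that kills x. *)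
Lemma abelian_pgroupP p (G : zmodType) : prime p ->
  abelian_pgroup p G <-> p_torsion p G.
Proof.
move=> pp; split=> [pG x|pG x x0].
  have [->|/pG[n [_ xn _]]] := eqVneq x 0; first by exists 0%N; rewrite mul0rn.
  by exists n.
have [k xk] := pG x.
have ex : exists m, (0 < m)%N && (x *+ m == 0).
  by exists (p ^ k)%N; rewrite expn_gt0 prime_gt0 //= xk.
case: (ex_minnP ex) => m /andP[m0 /eqP xm] mmin.
have : (m %| p ^ k)%N.
  rewrite /dvdn; apply: contraT; rewrite -lt0n => r0.
  have := mmin (p ^ k %% m)%N; rewrite r0 /= leqNgt ltn_pmod //.
  apply; move/eqP: xk; rewrite {1}(divn_eq (p ^ k) m) mulrnDr mulnC mulrnA xm.
  by rewrite mul0rn add0r.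
move=> /(dvdn_pfactor _ _ pp)[n _ mE]; exists n; rewrite -mE; split=> // j j0 xj.
by apply: mmin; rewrite j0 xj /=.
Qed.

Definition pure_hom (G H : zmodType) (f : G -> H) :=
  forall n g h, f g = h *+ n -> exists g', g = g' *+ n.

Lemma pure_embedding_pure_hom (G H : zmodType) (f : {additive G -> H}) :
  pure_embedding f -> injective f /\ pure_hom f.
Proof.
move=> [fI [_ pf]]; split=> // n g h fgh.
have : ([set h *+ n | h in [set: H]] `&` range f)%classic (f g).
  by split; [exists h | exists g].
rewrite pf => -[_ [g' _ <-]]; rewrite -raddfMn => /fI <-; by exists g'.
Qed.

(** In a p-group the integers prime to p act invertibly, so only powers of p
    have to be tested. *)
Lemma pure_embedding_p_powers p (G H : zmodType) (f : {additive G -> H}) :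
  prime p -> p_torsion p G -> injective f ->
  (forall k g h, f g = h *+ p ^ k -> exists g', g = g' *+ p ^ k) ->
  pure_embedding f.
Proof.
move=> pp pG fI fp; split=> //; split.
  split; first by rewrite inE; exists 0; rewrite ?raddf0.
  move=> _ _ /set_mem[x _ <-] /set_mem[y _ <-]; rewrite inE.
  by exists (x - y); rewrite ?raddfB.
move=> n; apply/seteqP; split=> [_ [[h _ <-] [g _ fg]]|_ [_ [g _ <-] <-]]; last first.
  by split; [exists (f g) | exists (g *+ n); rewrite ?raddfMn].
suff [g' gE] : exists g', g = g' *+ n.
  by exists (f g'); [exists g' | rewrite -fg gE raddfMn].
have [n0|n0] := posnP n.
  exists 0; rewrite mul0rn; apply: fI; by rewrite fg n0 mulr0n raddf0.
have [g1 g1E] : exists g1, g = g1 *+ p ^ logn p n.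
  apply: (fp _ _ (h *+ n`_(p^'))); rewrite fg -mulrnA -p_part mulnC.
  by rewrite partnC.
have [l g1l] := pG g1.
have cop : coprime n`_(p^') (p ^ l).
  by rewrite coprime_sym coprimeXl // (@pnat_coprime p) ?pnat_id ?part_pnat.
have [a b ab _] := egcdnP (p ^ l) (part_gt0 p^' n).
have aE : (a * n = p ^ logn p n + p ^ l * (b * p ^ logn p n))%N.
  rewrite -{1}(partnC p n0) p_part [(p ^ _ * _)%N]mulnC mulnA ab (eqP cop).
  by rewrite mulnDl mul1n addnC mulnAC mulnC mulnA [(_ * b)%N]mulnC -!mulnA [(b * _)%N]mulnCA.
exists (g1 *+ a); rewrite -mulrnA aE mulrnDr g1E.
by rewrite [g1 *+ (p ^ l * _)]mulrnA g1l mul0rn addr0.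
Qed.

(** * Homomorphisms into powers of the divisible group QZ *)

(** Otherwise k and p are coprime, and x is in S by Bezout. *)
Lemma prime_multiple_mem (V : zmodType) (S : subgroup V) p x (k : int) : prime p ->
  S (x *+ p) -> S (x *~ k) -> ~ S x -> exists k', k = k' * p%:Z.
Proof.
move=> pp Sxp Sxk Sx; apply/dvdzP; apply: contrapT => /negP pk; apply: Sx.
have cop : gcdz k p = 1.
  by apply/eqP; rewrite -[_ == _]/(coprimez k p) coprimez_sym coprimezE prime_coprime.
have [u [v uv]] := Bezoutz k p.
rewrite -[x]mulr1z -cop -uv mulrzDr [u * k]mulrC [v * _]mulrC !mulrzA.
by apply: subgroupD; apply: subgroupMz.
Qed.

Lemma first_multiple_mem (V : zmodType) (D : subgroup V) p x :
  p_torsion p V -> ~ D x -> exists n, ~ D (x *+ n) /\ D (x *+ n *+ p).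
Proof.
move=> pV Dx; have ex : exists k, `[< D (x *+ p ^ k) >].
  by have [k xk] := pV x; exists k; apply/asboolP; rewrite xk; exact: subgroup0.
case: (ex_minnP ex) => -[/asboolP|k /asboolP Dk kmin]; first by rewrite expn0.
exists (p ^ k)%N; split; last by rewrite -mulrnA -expnSr.
by move=> /asboolP/kmin; rewrite ltnn.
Qed.

Lemma fctMn (I : Type) (V : zmodType) (y : I -> V) n i : (y *+ n) i = y i *+ n.
Proof. by elim: n => [|n IH]; rewrite ?mulr0n // !mulrS -IH. Qed.

Lemma zero_subgroupB (V : zmodType) (x y : V) : x = 0 -> y = 0 -> x - y = 0.
Proof. by move=> -> ->; rewrite subr0. Qed.

Definition zero_subgroup (V : zmodType) : subgroup V :=
  @Subgroup V (fun x => x = 0) (erefl 0) (@zero_subgroupB V).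

Section KernelPrescribed.
Variables (p : nat) (p_prime : prime p) (G : zmodType) (pG : p_torsion p G).
Variables (T : Type) (A0 S : subgroup G) (j : G -> T).
Hypothesis jI : forall x y, S x -> S y -> j x = j y -> x = y.

Let graph := G * (T -> QZ) -> Prop.
Definition graph_dom (R : graph) x := exists y, R (x, y).

(** Graphs of partial homomorphisms to T -> QZ that kill A0 and whose kernel on S
    lies in A0.  Values may only use the coordinates of those elements of S that
    are in the domain already, so that j x is a fresh coordinate for a new x. *)
Record kernel_graph (R : graph) : Prop := KernelGraph {
  kg_sub : forall x y, R x -> R y -> R (x - y);
  kg_fun : forall y, R (0, y) -> y = 0;
  kg_ker : forall x, R (x, 0) -> S x -> A0 x;
  kg_A0 : forall a, A0 a -> R (a, 0);
  kg_supp : forall x y, R (x, y) -> exists s : seq G, forall t, y t <> 0 ->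
    exists z, [/\ z \in s, S z, graph_dom R z & t = j z] }.

Lemma kg_0 R : kernel_graph R -> R 0.
Proof. by move=> gR; apply: (kg_A0 gR); exact: subgroup0. Qed.

Definition graph_subgroup R (gR : kernel_graph R) : subgroup (G * (T -> QZ))%type :=
  Subgroup (kg_0 gR) (kg_sub gR).

Lemma dom_0 R : kernel_graph R -> graph_dom R 0.
Proof. by move=> gR; exists 0; exact: kg_0. Qed.

Lemma dom_sub R : kernel_graph R ->
  forall x y, graph_dom R x -> graph_dom R y -> graph_dom R (x - y).
Proof. by move=> gR x y [x' Rx] [y' Ry]; exists (x' - y'); exact: (kg_sub gR Rx Ry). Qed.

Definition dom_subgroup R (gR : kernel_graph R) : subgroup G :=
  Subgroup (dom_0 gR) (dom_sub gR).

Lemma pairMz (U V : zmodType) (x : U) (y : V) (k : int) :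
  ((x, y) : (U * V)%type) *~ k = (x *~ k, y *~ k).
Proof.
rewrite [LHS]surjective_pairing; congr (_, _).
- exact: (raddfMz (fst : {additive (U * V)%type -> U}) k (x, y)).
- exact: (raddfMz (snd : {additive (U * V)%type -> V}) k (x, y)).
Qed.

Lemma fctMzE (y : T -> QZ) (k : int) t : (y *~ k) t = y t *~ k.
Proof. by case: k => n; rewrite -?pmulrn -?nmulrn; [|congr (- _)]; rewrite fctMn. Qed.

(** Adjoining x to the domain, when p x is already there with image z: any p-th
    part y of z will do, but for x in S the value at the fresh coordinate j x is
    made nonzero, which keeps the kernel from growing inside S. *)
Lemma kernel_graph_step R (gR : kernel_graph R) x :
  ~ graph_dom R x -> graph_dom R (x *+ p) ->
  S x \/ (forall s, S s -> graph_dom R s) ->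
  exists R', [/\ kernel_graph R', forall q, R q -> R' q & graph_dom R' x].
Proof.
move=> Rx [z Rpx] xS; have p0 := prime_gt0 p_prime.
have /choice[half halfP] : forall c : QZ, exists d, d *+ p = c /\ (c = 0 -> d = 0).
  move=> c; have [->|c0] := pselect (c = 0); first by exists 0; rewrite mul0rn.
  by have [d dc] := QZ_divisible c p0; exists d.
pose y t := half (z t) + (if `[< S x /\ t = j x >] then QZfrac p 1 else 0).
have u1p : QZfrac p 1 *+ p = 0 by rewrite QZfracS ?QZfrac0.
have yp : y *+ p = z.
  apply/funext => t; rewrite fctMn /y mulrnDl (halfP _).1.
  by case: ifP => _; rewrite ?u1p ?mul0rn addr0.
pose gRs := graph_subgroup gR; pose D := dom_subgroup gR.
have Rxk k : D (x *~ k) -> R (x *~ k, y *~ k).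
  move=> Dk; have [k' ->] : exists k', k = k' * p%:Z.
    by apply: prime_multiple_mem Dk Rx => //; exists z.
  rewrite mulrC !mulrzA -!pmulrn yp -pairMz.
  exact: (subgroupMz (S := gRs)).
pose R' q := exists a b k, R (a, b) /\ q = (a + x *~ k, b + y *~ k).
have R'dom q : R' q -> D q.1 -> R q.
  move=> [a [b [k [Rab ->]]]] /= Dq.
  have : D (x *~ k).
    by rewrite -[x *~ k](addKr a) addrC; apply: (subgroupB (s := D)); last by exists b.
  by move=> /Rxk; exact: (subgroupD (S := gRs) Rab).
have RR' q : R q -> R' q.
  by move=> Rq; exists q.1, q.2, 0; rewrite !mulr0z !addr0; case: q Rq.
exists R'; split=> //; last first.
  by exists y, 0, 0, 1; split; [exact: kg_0 | rewrite !mulr1z !add0r].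
have R'supp a b k : R (a, b) -> exists s : seq G, forall t, (b + y *~ k) t <> 0 ->
    exists z, [/\ z \in s, S z, graph_dom R' z & t = j z].
  move=> Rab; have [sb sbP] := kg_supp gR Rab; have [sz szP] := kg_supp gR Rpx.
  have sub w : graph_dom R w -> graph_dom R' w by case=> v Rv; exists v; exact: RR'.
  exists (sb ++ x :: sz) => t bt.
  have [/sbP[w [wb Sw Dw tw]]|b0] := pselect (b t <> 0).
    by exists w; split=> //; [rewrite mem_cat wb | exact: sub].
  have [/szP[w [wz Sw Dw tw]]|z0] := pselect (z t <> 0).
    by exists w; split=> //; [rewrite mem_cat inE wz !orbT | exact: sub].
  have [[Sx tx]|nx] := pselect (S x /\ t = j x).
    exists x; split=> //; first by rewrite mem_cat inE eqxx orbT.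
    by exists y, 0, 0, 1; split; [exact: kg_0 | rewrite !mulr1z !add0r].
  case: bt; move: b0 z0 => /contrapT b0 /contrapT z0.
  have -> : (b + y *~ k) t = b t + (y *~ k) t by [].
  rewrite fctMzE b0 add0r /y (halfP _).2 //.
  by case: asboolP => // _; rewrite addr0 mul0rz.
split.
- move=> _ _ [a [b [k [Rab ->]]]] [a' [b' [k' [Rab' ->]]]].
  exists (a - a'), (b - b'), (k - k'); split; first exact: (kg_sub gR Rab Rab').
  rewrite -[LHS]/(a + x *~ k - (a' + x *~ k'), b + y *~ k - (b' + y *~ k')).
  by congr (_, _); rewrite mulrzBr opprD addrACA.
- by move=> w /R'dom R0; apply: (kg_fun gR); apply: R0; exact: (subgroup0 D).
- move=> s R's Ss; suff Ds : D s by apply: (kg_ker gR) => //; exact: R'dom.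
  case: xS => [Sx|]; last exact.
  case: R's => a [b [k [Rab [-> b0]]]].
  have fresh w v : R (w, v) -> v (j x) = 0.
    move=> /(kg_supp gR)[l lP]; apply: contrapT => /lP[x' [_ Sx' Dx' /(jI Sx Sx') xx']].
    by apply: Rx; rewrite xx'.
  have u1k : QZfrac p 1 *~ k = 0.
    have := congr1 (@^~ (j x)) b0; rewrite /= -[RHS]/(b (j x) + (y *~ k) (j x)).
    rewrite fctMzE (fresh _ _ Rab) add0r /y (halfP _).2 ?(fresh _ _ Rpx) // add0r.
    by rewrite (asboolT (conj Sx erefl)).
  have [k' kE] := @prime_multiple_mem QZ (zero_subgroup QZ) p (QZfrac p 1) k p_prime
    u1p u1k (QZfrac1_neq0 (prime_gt1 p_prime)).
  apply: (subgroupD (S := D)); first by exists b.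
  rewrite kE mulrC mulrzA; apply: (subgroupMz (S := D)).
  by exists z.
- by move=> a /(kg_A0 gR)/RR'.
- by move=> a b [a' [b' [k [Rab [_ ->]]]]]; exact: (R'supp _ _ _ Rab).
Qed.

Lemma kernel_graph_total : exists R, kernel_graph R /\ forall x, graph_dom R x.
Proof.
pose P (R : set (G * (T -> QZ))) := (R = set0 \/ kernel_graph R)%classic.
have P0 : kernel_graph (fun q => A0 q.1 /\ q.2 = 0).
  split=> [x y [Ax x0] [Ay y0]|y [//]|x [] //|//|x y [_ /= ->]].
  - by split; [exact: subgroupB | rewrite /= x0 y0 subr0].
  - by exists [::] => t.
have [F FP Ftot|R [PR Rmax]] := @Zorn_bigcup _ P.
  have [[X0 FX0 X0n]|none] := pselect (exists2 X, F X & X <> set0); last first.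
    left; apply/seteqP; split=> // q [X FX Xq]; case: none; exists X => // X0.
    by rewrite X0 in Xq.
  have good X q : F X -> X q -> kernel_graph X.
    by move=> /FP[-> //|].
  have {}X0n : kernel_graph X0 by case: (FP _ FX0).
  right; split=> [x y [X FX Xx] [Y FY Yy]|y [X FX Xy]|x [X FX Xx]|a Aa|x y [X FX Xx]].
  - have [XY|YX] := Ftot X Y FX FY.
      by exists Y => //; apply: (kg_sub (good _ _ FY Yy)) => //; exact: XY.
    by exists X => //; apply: (kg_sub (good _ _ FX Xx)) => //; exact: YX.
  - exact: (kg_fun (good _ _ FX Xy)).
  - exact: (kg_ker (good _ _ FX Xx)).
  - by exists X0 => //; exact: kg_A0.
  - have [s sP] := kg_supp (good _ _ FX Xx) Xx; exists s => t /sP[z [zs Sz [w Xw] tz]].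
    by exists z; split=> //; exists w, X.
have gR : kernel_graph R.
  case: PR => // R0; case: (Rmax (fun q => A0 q.1 /\ q.2 = 0)); last by right.
  rewrite R0; split; first exact: sub0set.
  by move=> /(_ 0); apply; split=> //; exact: subgroup0.
exists R; split=> // x0; apply: contrapT => Dx0.
have [x [Dx Dpx xS]] : exists x, [/\ ~ graph_dom R x, graph_dom R (x *+ p) &
    S x \/ (forall s, S s -> graph_dom R s)].
  have [SD|/existsNP[s /not_implyP[Ss Ds]]] := pselect (forall s, S s -> graph_dom R s).
    have [n [Dn Dnp]] := first_multiple_mem (D := dom_subgroup gR) pG Dx0.
    by exists (x0 *+ n); split=> //; right.
  have [n [Dn Dnp]] := first_multiple_mem (D := dom_subgroup gR) pG Ds.
  by exists (s *+ n); split=> //; left; exact: subgroupMn.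
have [R' [gR' RR' R'x]] := kernel_graph_step gR Dx Dpx xS.
apply: (Rmax R'); last by right.
split=> // R'R; apply: Dx; case: R'x => y /R'R; by exists y.
Qed.

(** For A0 = p^n G and S = G this embeds G / p^n G into a sum of copies of Z/p^n:
    as r kills p^n G, its values have exponent p^n.  For A0 = 0 it embeds G into a
    sum of copies of Z(p^oo).  A proper S lets r extend to G a homomorphism that
    is only controlled on S, with no more coordinates than S has elements. *)
Theorem hom_with_kernel : exists r : G -> T -> QZ, [/\
  forall x y, r (x - y) = r x - r y, forall a, A0 a -> r a = 0,
  forall s, S s -> r s = 0 -> A0 s &
  forall x, exists s : seq G, forall t, r x t <> 0 ->
    exists z, [/\ z \in s, S z & t = j z]].
Proof.
have [R [gR tot]] := kernel_graph_total; have [r rP] := choice tot.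
have uniq x y y' : R (x, y) -> R (x, y') -> y = y'.
  move=> h h'; apply/eqP; rewrite -subr_eq0; apply/eqP; apply: (kg_fun gR).
  by have := kg_sub gR h h'; rewrite -[(x, y) - _]/(x - x, y - y') subrr.
exists r; split=> [x y|a Aa|s Ss rs|x].
- by apply: uniq (rP _) _; exact: (kg_sub gR (rP x) (rP y)).
- by apply: uniq (rP _) _; exact: kg_A0.
- by apply: (kg_ker gR) => //; rewrite -rs.
- have [s sP] := kg_supp gR (rP x); exists s => t /sP[z [zs Sz _ tz]].
  by exists z.
Qed.

End KernelPrescribed.

(** * A universal group built from a filtration of the index set *)

Lemma additive_of_sub (G H : zmodType) (f : G -> H) :
  (forall x y, f (x - y) = f x - f y) -> exists g : {additive G -> H}, g =1 f.
Proof.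
move=> fB; pose g : {additive G -> H} := HB.pack f (GRing.isZmodMorphism.Build _ _ f fB).
by exists g.
Qed.

Section Universal.
Variables (p : nat) (p_prime : prime p) (T : Type) (P : nat -> T -> Prop).

(** The elements of the sum over i of the torsion part of
      (sum of Z(p^oo)) x prod_(n > 0) (sum of Z/p^n),
    where the copies in the i-th summand are indexed by P i, and n = 0 stands for
    the divisible factor. *)
Record in_universal (phi : nat -> nat -> T -> QZ) : Prop := InUniversal {
  iu_torsion : exists k, phi *+ p ^ k = 0;
  iu_finite : forall i n, exists s : seq T, forall t, phi i n t <> 0 -> List.In t s;
  iu_exponent : forall i n t, phi i n.+1 t *+ p ^ n.+1 = 0;
  iu_index : forall i n t, phi i n t <> 0 -> P i t;
  iu_level : exists J, forall i n t, (J <= i)%N -> phi i n t = 0 }.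

Lemma in_universal0 : in_universal 0.
Proof.
split=> [|i n|i n t|i n t|]; [by exists 0%N; rewrite mul0rn|by exists [::] | | by []| by exists 0%N].
by rewrite mul0rn.
Qed.

Lemma in_universalB phi psi : in_universal phi -> in_universal psi ->
  in_universal (phi - psi).
Proof.
move=> [[k1 h1] f1 e1 d1 [J1 l1]] [[k2 h2] f2 e2 d2 [J2 l2]].
have nz i n t : phi i n t - psi i n t <> 0 -> phi i n t <> 0 \/ psi i n t <> 0.
  by move=> h; apply: contrapT => /not_orP[/contrapT a /contrapT b]; apply: h; rewrite a b subr0.
split.
- by exists (k1 + k2)%N; rewrite expnD mulrnBl mulrnA h1 mul0rn mulnC mulrnA h2 mul0rn subr0.
- move=> i n; have [s1 s1P] := f1 i n; have [s2 s2P] := f2 i n; exists (s1 ++ s2) => t /nz h.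
  by apply: List.in_or_app; case: h => [/s1P|/s2P]; [left|right].
- by move=> i n t; rewrite -[(phi - psi) _ _ _]/(phi i n.+1 t - psi i n.+1 t) mulrnBl e1 e2 subr0.
- by move=> i n t /nz[/d1|/d2].
- exists (maxn J1 J2) => i n t; rewrite geq_max => /andP[i1 i2].
  by rewrite -[LHS]/(phi i n t - psi i n t) l1 // l2 // subr0.
Qed.

Definition universal_subgroup : subgroup (nat -> nat -> T -> QZ) :=
  Subgroup in_universal0 in_universalB.

Definition universal_group : zmodType := subgroup_type universal_subgroup.

Lemma universal_p_torsion : p_torsion p universal_group.
Proof.
move=> x; have [k xk] := iu_torsion (sgvalP x); exists k.
by apply: sgval_inj; rewrite sgvalMn xk sgval0.
Qed.

Section Embedding.
Variables (G : zmodType) (pG : p_torsion p G) (Gs : nat -> subgroup G).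
Hypothesis Gs0 : forall g, Gs 0%N g -> g = 0.
Hypothesis GsS : forall m n g, (m <= n)%N -> Gs m g -> Gs n g.
Hypothesis Gs_cover : forall g, exists n, Gs n g.
Variable j : nat -> G -> T.
Hypothesis jI : forall i x y, Gs i.+1 x -> Gs i.+1 y -> j i x = j i y -> x = y.
Hypothesis jP : forall i x, Gs i.+1 x -> P i (j i x).

Definition add_multiples (S : subgroup G) q x := exists a h, S a /\ x = a + h *+ q.

Lemma add_multiples0 (S : subgroup G) q : add_multiples S q 0.
Proof. by exists 0, 0; rewrite mul0rn addr0; split=> //; exact: subgroup0. Qed.

Lemma add_multiplesB (S : subgroup G) q x y :
  add_multiples S q x -> add_multiples S q y -> add_multiples S q (x - y).
Proof.
move=> [a [h [Sa ->]]] [b [k [Sb ->]]]; exists (a - b), (h - k).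
by split; [exact: subgroupB | rewrite mulrnBl opprD addrACA].
Qed.

Definition add_multiples_subgroup S q : subgroup G :=
  Subgroup (add_multiples0 S q) (@add_multiplesB S q).

(** The component (i, n) kills Gs i and, for n > 0, all multiples of p^n, hence
    takes values of exponent p^n; on Gs (i+1) its kernel is as small as this
    permits.  So an element of Gs (i+1) whose image is divisible by p^n lies in
    Gs i + p^n G, and induction on i gives purity.  The components n = 0 give
    injectivity, as they see the elements of infinite height. *)
Theorem universal_embedding : exists f : {additive G -> universal_group}, pure_embedding f.
Proof.
pose q n := if n is 0%N then 0%N else (p ^ n)%N.
pose A0 (m : nat * nat) := add_multiples_subgroup (Gs m.1) (q m.2).
have /choice[r rP] := fun m => hom_with_kernel p_prime pG (A0 m) (@jI m.1).
pose F g i n := r (i, n) g.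
have FB x y : F (x - y) = F x - F y.
  by apply/funext => i; apply/funext => n; case: (rP (i, n)) => h _ _ _; exact: h.
have [f0 f0E] := additive_of_sub FB.
have FMn x n : F (x *+ n) = F x *+ n by rewrite -!f0E raddfMn.
have FA0 i n a : A0 (i, n) a -> F a i n = 0.
  by case: (rP (i, n)) => _ h _ _; exact: h.
have Gs_A0 i n a : Gs i a -> A0 (i, n) a.
  by move=> ga; exists a, 0; rewrite mul0rn addr0.
have FU g : in_universal (F g).
  split.
  - by have [k gk] := pG g; exists k; rewrite -FMn gk -f0E raddf0.
  - move=> i n; case: (rP (i, n)) => _ _ _ /(_ g)[s sP].
    exists (map (j i) s) => t /sP[z [zs _ ->]]; apply: List.in_map.
    elim: s zs {sP} => //= x s IH; rewrite inE => /predU1P[->|/IH]; by [left|right].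
  - move=> i n t; have h := FMn g (p ^ n.+1)%N.
    have : F (g *+ p ^ n.+1) i n.+1 t = 0.
      rewrite FA0 //; exists 0, g; rewrite add0r; split=> //; exact: subgroup0.
    by rewrite h !fctMn.
  - by move=> i n t; case: (rP (i, n)) => _ _ _ /(_ g)[s sP] /sP[z [_ Sz ->]]; exact: jP.
  - have [J gJ] := Gs_cover g; exists J => i n t Ji.
    by rewrite (FA0 i n g) //; apply: Gs_A0; exact: GsS gJ.
have /choice[f fE] : forall g, exists y : universal_group, sgval y = F g.
  by move=> g; apply: sgval_ex; exact: FU.
have [fa faE] : exists fa : {additive G -> universal_group}, fa =1 f.
  by apply: additive_of_sub => x y; apply: sgval_inj; rewrite sgvalB !fE FB.
exists fa; apply: (pure_embedding_p_powers p_prime pG).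
  apply: raddf_inj => g; rewrite faE => fg0.
  have Fg0 : F g = 0 by rewrite -fE fg0 sgval0.
  have [n] := Gs_cover g; elim: n => [|n IH]; first exact: Gs0.
  move=> gn; apply: IH; case: (rP (n, 0%N)) => _ _ /(_ g gn) h _.
  have [|a [b [ga ->]]] := h; last by rewrite mulr0n addr0.
  by rewrite -[LHS]/(F g n 0%N) Fg0.
case=> [g _ _|k g h]; first by exists g.
have [n] := Gs_cover g; elim: n g h => [|n IH] g h gn fgh.
  by exists 0; rewrite mul0rn (Gs0 gn).
have Fgh : F g = sgval h *+ p ^ k.+1 by rewrite -fE -faE fgh sgvalMn.
have [a [b [ga gE]]] : A0 (n, k.+1) g.
  case: (rP (n, k.+1)) => _ _ kr _; apply: kr => //.
  apply/funext => t; rewrite -[LHS]/(F g n k.+1 t) Fgh !fctMn.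
  exact: (iu_exponent (sgvalP h)).
have [|a' a'E] := IH a (h - fa b) ga.
  by rewrite mulrnBl -fgh gE raddfD raddfMn addrK.
by exists (a' + b); rewrite mulrnDl -a'E.
Qed.

End Embedding.

(** For each pair (i, n), list the nonzero coordinates with their values. *)
Lemma embeds_supported (Q : T -> Prop) (a b : {t | Q t}) : a <> b ->
  embeds {phi : nat -> nat -> T -> QZ |
      (forall i n, exists s : seq T, forall t, phi i n t <> 0 -> List.In t s) /\
      forall i n t, phi i n t <> 0 -> Q t}
    (nat -> {t | Q t}).
Proof.
move=> ab; pose X := ({t | Q t} * QZ)%type.
have XQ : embeds X (nat -> {t | Q t}).
  apply: embeds_trans (embeds_prod (embeds_refl _) QZ_countable) _.
  apply: embeds_trans (embeds_nat_prod_seq ab).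
  by exists (fun x => (x.2, x.1)) => -[? ?] [? ?] /= [-> ->].
apply: (@embeds_trans (nat -> nat -> seq X)).
  pose R (phi : {phi : nat -> nat -> T -> QZ |
      (forall i n, exists s : seq T, forall t, phi i n t <> 0 -> List.In t s) /\
      forall i n t, phi i n t <> 0 -> Q t}) (c : nat -> nat -> seq X) :=
    forall i n, (forall t, sval phi i n t <> 0 ->
        exists2 x, List.In x (c i n) & sval x.1 = t) /\
      forall x, List.In x (c i n) -> sval phi i n (sval x.1) = x.2.
  apply: (embeds_rel (R := R)) => [[phi [fin sup]]|phi psi c Rphi Rpsi].
    rewrite /R /=.
    suff /choice[c cP] : forall m : nat * nat, exists c : seq X,
        (forall t, phi m.1 m.2 t <> 0 -> exists2 x, List.In x c & sval x.1 = t) /\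
        forall x, List.In x c -> phi m.1 m.2 (sval x.1) = x.2.
      by exists (fun i n => c (i, n)) => i n; exact: (cP (i, n)).
    move=> [i n] /=; have [s sP] := fin i n.
    suff [c [cs cP]] : exists c : seq X, (forall t, List.In t s -> phi i n t <> 0 ->
        exists2 x, List.In x c & sval x.1 = t) /\
        forall x, List.In x c -> phi i n (sval x.1) = x.2.
      by exists c; split=> // t tn0; apply: cs => //; exact: sP.
    elim: s {sP} => [|t s [c [cs cP]]]; first by exists [::].
    have [t0|tn0] := pselect (phi i n t = 0).
      by exists c; split=> // u /= [<- //|]; exact: cs.
    exists ((exist _ t (sup i n t tn0), phi i n t) :: c).
    split=> [u /= [<- _|us /(cs u us)[x xc xu]]|x /= [<- //|]]; last exact: cP.
      by exists (exist _ t (sup i n t tn0), phi i n t); [left|].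
    by exists x => //; right.
  have agree (phi' psi' : {phi | _}) i n t : R phi' c -> R psi' c ->
      sval phi' i n t <> 0 -> sval phi' i n t = sval psi' i n t.
    move=> Rp Rp' /((Rp i n).1 t)[x xc <-].
    by rewrite ((Rp i n).2 _ xc) ((Rp' i n).2 _ xc).
  apply/sval_inj/funext => i; apply/funext => n; apply/funext => t.
  have [phi0|/agree] := pselect (sval phi i n t = 0); last exact.
  have [psi0|/agree h] := pselect (sval psi i n t = 0); first by rewrite phi0.
  by rewrite (h phi).
have XX : embeds (seq X) (nat -> {t | Q t}).
  apply: embeds_trans (embeds_list_seq (a := (a, 0)) (b := (b, 0)) _) _.
    by case.
  exact: embeds_trans (embeds_fun _ XQ) (embeds_seq_seq _).
apply: embeds_trans (embeds_seq_seq _).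
apply: embeds_fun; apply: embeds_trans (embeds_seq_seq _).
exact: embeds_fun.
Qed.

Lemma embeds_universal L (q : L -> T) : injective q -> (forall x, exists i, P i (q x)) ->
  embeds L universal_group.
Proof.
move=> qI qP; pose R x (phi : universal_group) := exists i,
  sgval phi i 1%N (q x) <> 0 /\ forall i' t, sgval phi i' 1%N t <> 0 -> t = q x.
apply: (embeds_rel (R := R)) => [x|x x' phi [i [n0 _]] [i' [_ h]]]; last first.
  by apply: qI; exact: h n0.
have [i Pi] := qP x.
pose phi i' n t : QZ := if `[< [/\ i' = i, n = 1%N & t = q x] >] then QZfrac p 1 else 0.
have u1p : QZfrac p 1 *+ p = 0 by rewrite QZfracS ?QZfrac0 // prime_gt0.
have phiU : in_universal phi.
  split=> [|i' n|i' n t|i' n t|].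
  - exists 1%N; rewrite expn1; apply/funext => i'; apply/funext => n; apply/funext => t.
    by rewrite !fctMn /phi; case: ifP => _; rewrite ?u1p ?mul0rn.
  - by exists [:: q x] => t; rewrite /phi; case: asboolP => [[_ _ ->] _|//]; left.
  - rewrite /phi; case: asboolP => [[_ -> _]|_]; last by rewrite mul0rn.
    by rewrite expn1.
  - by rewrite /phi; case: asboolP => [[-> _ ->]|].
  - exists i.+1 => i' n t ii'; rewrite /phi; case: asboolP => // -[ei _ _].
    by rewrite ei ltnn in ii'.
have [y yE] := sgval_ex (phiU : universal_subgroup phi).
exists y, i; rewrite yE; split=> [|i' t].
  by rewrite /phi asboolT //; exact: QZfrac1_neq0 (prime_gt1 p_prime).
by rewrite /phi; case: asboolP => [[]|].
Qed.

(** What is left to check for a given L: a bound on the size of the group, room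
    for L in it, and a filtration of each small group that fits the index sets. *)
Lemma universal_group_universal (L : Type) (q : L -> T) :
  injective q -> (forall x, exists i, P i (q x)) -> embeds universal_group L ->
  (forall G : zmodType, p_torsion p G -> embeds G L ->
    exists (Gs : nat -> subgroup G) (j : nat -> G -> T),
    [/\ forall g, Gs 0%N g -> g = 0,
        forall m n g, (m <= n)%N -> Gs m g -> Gs n g,
        forall g, exists n, Gs n g &
        forall i, (forall x y, Gs i.+1 x -> Gs i.+1 y -> j i x = j i y -> x = y) /\
          forall x, Gs i.+1 x -> P i (j i x)]) ->
  universal_pgroup p L universal_group.
Proof.
move=> qI qP UL filt; split.
- by apply/abelian_pgroupP => //; exact: universal_p_torsion.
- by apply/card_eq_embeds; split=> //; exact: (embeds_universal qI).
- move=> G /(abelian_pgroupP _ p_prime) pG /card_le_embeds/(filt G pG).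
  move=> [Gs [j [h0 hS hc hj]]].
  apply: (universal_embedding pG h0 hS hc (j := j)) => i.
    by move=> x y; exact: (hj i).1.
  exact: (hj i).2.
Qed.

End Universal.

(** * Generated subgroups *)

Section Span.
Variables (V : zmodType) (I : Type) (x : I -> V).

Definition signed_sum (s : seq (I * bool)) : V :=
  \sum_(e <- s) (if e.2 then x e.1 else - x e.1).

Definition span (v : V) := exists s, v = signed_sum s.

Lemma span0 : span 0.
Proof. by exists [::]; rewrite /signed_sum big_nil. Qed.

Lemma spanB u v : span u -> span v -> span (u - v).
Proof.
move=> [s ->] [t ->]; exists (s ++ [seq (e.1, ~~ e.2) | e <- t]).
rewrite /signed_sum big_cat big_map /= -sumrN; congr (_ + _).
by apply: eq_bigr => -[i []] _ //=; rewrite opprK.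
Qed.

Definition span_subgroup : subgroup V := Subgroup span0 spanB.

Lemma span_gen i : span (x i).
Proof. by exists [:: (i, true)]; rewrite /signed_sum big_seq1. Qed.

Lemma embeds_span : embeds {v | span v} (seq (I * bool)).
Proof.
apply: (embeds_rel (R := fun v s => sval v = signed_sum s)) => [[v sv]//|u v s].
by move=> us vs; apply: sval_inj; rewrite us vs.
Qed.

Lemma span_ind (S : subgroup V) : (forall i, S (x i)) -> forall v, span v -> S v.
Proof.
move=> Sx _ [s ->]; rewrite /signed_sum; elim: s => [|[i b] s IH].
  by rewrite big_nil; exact: subgroup0.
rewrite big_cons; apply: subgroupD => //.
by case: b => /=; [exact: Sx | apply: subgroupN; exact: Sx].
Qed.

End Span.

Lemma span_sub (V : zmodType) I J (x : I -> V) (y : J -> V) v :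
  (forall i, exists j, y j = x i) -> span x v -> span y v.
Proof.
move=> xy; apply: (span_ind (S := span_subgroup y)) => i.
by have [j <-] := xy i; exact: span_gen.
Qed.

(** * Existence of universal groups *)

(** Here the filtration of G jumps from 0 to G in one step. *)
Lemma universal_of_power p (L : Type) : prime p -> embeds nat L ->
  embeds (nat -> L) L -> exists U : zmodType, universal_pgroup p L U.
Proof.
move=> pp [e eI] LL; exists (@universal_group p L (fun _ _ => True)).
apply: (universal_group_universal pp (q := id)) => [x y //|x| |]; first by exists 0%N.
  apply: embeds_trans LL.
  apply: (@embeds_trans (nat -> {t : L | True})); last exact/embeds_fun/embeds_sig.
  apply: embeds_trans (embeds_supported (a := exist _ (e 0%N) I) (b := exist _ (e 1%N) I) _).
    have sup (phi : @universal_group p L (fun _ _ => True)) :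
        (forall i n, exists s : seq L, forall t, sgval phi i n t <> 0 -> List.In t s) /\
        forall i n t, sgval phi i n t <> 0 -> True.
      by split=> // i n; exact: (iu_finite (sgvalP phi)).
    by exists (fun phi => exist _ (sgval phi) (sup phi)) => x y /(congr1 sval)/sgval_inj.
  by move=> /(congr1 sval)/eI.
move=> G pG [i iI].
pose full : subgroup G := @Subgroup G (fun=> True) I (fun _ _ _ _ => I).
exists (fun n => if n is 0%N then zero_subgroup G else full), (fun=> i); split=> //.
- move=> [|m] [|n] g //= _ ->; exact: subgroup0.
- by move=> g; exists 1%N.
- by move=> n; split=> // x y _ _ /iI.
Qed.

(** The coordinates of level i are indexed by the sequences in Q i: these are
    numerous enough for the subgroup generated by the elements numbered in Q i,
    and their countable power is no larger. *)
Lemma universal_of_filtration p (L : Type) (Q : nat -> L -> Prop) (a b : L) : prime p ->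
  a <> b -> Q 0%N a -> Q 0%N b -> (forall m n x, (m <= n)%N -> Q m x -> Q n x) ->
  (forall x, exists n, Q n x) -> (forall n, ~ embeds L (nat -> {x | Q n x})) ->
  exists U : zmodType, universal_pgroup p L U.
Proof.
move=> pp ab Qa Qb QS Qcov small.
pose P i (f : nat -> L) := forall m, Q i (f m).
have PS m n f : (m <= n)%N -> P m f -> P n f by move=> mn Pf k; exact: QS (Pf k).
exists (@universal_group p (nat -> L) P).
apply: (universal_group_universal pp (q := fun x _ => x)).
- by move=> x y /(congr1 (@^~ 0%N)).
- by move=> x; have [n Qx] := Qcov x; exists n.
- have /choice[rk rkP] := fun phi : @universal_group p (nat -> L) P => iu_level (sgvalP phi).
  apply: (embeds_ranked (rk := rk) wo_nat) => n Ln; apply: (small n).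
  apply: embeds_trans Ln _.
  apply: (@embeds_trans (nat -> {f | P n f})); last first.
    apply: embeds_trans (embeds_seq_seq _); apply: embeds_fun.
    exists (fun (f : {f | P n f}) m => exist (Q n) (sval f m) ((proj2_sig f : P n (sval f)) m)) => f g fg.
    by apply/sval_inj/funext => m; have /= := congr1 (fun h => sval (h m)) fg.
  have Pa : P n (fun=> a) by move=> m; exact: QS Qa.
  have Pb : P n (fun=> b) by move=> m; exact: QS Qb.
  apply: embeds_trans (embeds_supported (a := exist _ _ Pa) (b := exist _ _ Pb) _).
    have sup (phi : {phi | ~ (n < rk phi)%N}) :
        (forall i m, exists s : seq (nat -> L),
          forall t, sgval (sval phi) i m t <> 0 -> List.In t s) /\
        forall i m t, sgval (sval phi) i m t <> 0 -> P n t.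
      split=> [i m|i m t tn0]; first exact: (iu_finite (sgvalP (sval phi))).
      apply: PS (iu_index (sgvalP (sval phi)) tn0).
      have /negP := proj2_sig phi; rewrite -leqNgt => /(leq_trans _); apply.
      rewrite leqNgt; apply/negP => /ltnW/(rkP (sval phi) i m t); exact: tn0.
    exists (fun phi => exist _ (sgval (sval phi)) (sup phi)).
    by move=> x y /(congr1 sval)/sgval_inj/sval_inj.
  by move=> /(congr1 (fun f => sval f 0%N)).
- move=> G pG [i iI].
  have /choice[x xP] : forall l, exists g : G, (exists g', i g' = l) -> i g = l.
    by move=> l; have [[g gl]|n] := pselect (exists g', i g' = l); [exists g|exists 0].
  pose xs n (l : {l | Q n l}) := x (sval l).
  pose Gs n := if n is m.+1 then span_subgroup (@xs m) else zero_subgroup G.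
  have /choice[j jP] : forall n, exists j : G -> nat -> L,
      (forall x y, Gs n.+1 x -> Gs n.+1 y -> j x = j y -> x = y) /\
      forall x, Gs n.+1 x -> P n (j x).
    move=> n; have Qna : Q n a by exact: QS Qa.
    have Qnb : Q n b by exact: QS Qb.
    have ab' : exist _ a Qna <> exist _ b Qnb by move=> /(congr1 sval).
    have [h hI] : embeds {g | Gs n.+1 g} (nat -> {l | Q n l}).
      apply: embeds_trans (embeds_span _) _.
      apply: embeds_trans (embeds_list_seq
        (a := (exist _ a Qna, true)) (b := (exist _ b Qnb, true)) _) _; first by case.
      apply: embeds_trans (embeds_seq_seq _); apply: embeds_fun.
      apply: embeds_trans (embeds_nat_prod_seq ab').
      exists (fun e => (nat_of_bool e.2, e.1)) => -[l c] [l' c'] /= [cc ->].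
      by case: c c' cc => -[].
    exists (fun g => if pselect (Gs n.+1 g) is left H
      then fun m => sval (h (exist _ g H) m) else fun=> a).
    split=> [g g' Sg Sg'|g Sg].
      case: pselect => // H; case: pselect => // H' e.
      suff /hI/(congr1 sval) : h (exist _ g H) = h (exist _ g' H') by [].
      by apply/funext => m; apply: sval_inj; exact: (congr1 (@^~ m) e).
    by case: pselect => // H m; exact: proj2_sig (h _ m).
  exists Gs, j; split=> //.
  + move=> [|m] [|n] g //; first by move=> _ ->; exact: subgroup0.
    rewrite ltnS => mn; apply: span_sub => -[l Ql]; by exists (exist _ l (QS _ _ _ mn Ql)).
  + move=> g; have [n Qn] := Qcov (i g); exists n.+1.
    have -> : g = xs n (exist _ (i g) Qn) by apply: iI; rewrite xP //; exists g.
    exact: span_gen.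
Qed.

Theorem universal_exists p (L : Type) : prime p -> embeds nat L ->
  embeds (nat -> L) L \/ (forall M, ~ embeds L M -> ~ embeds L (nat -> M)) ->
  exists U : zmodType, universal_pgroup p L U.
Proof.
move=> pp nL [LL|/(power_or_filtration nL)[LL|]]; [exact: universal_of_power..|].
move=> [Q [a [b [ab Qa Qb [QS Qc] small]]]].
exact: (universal_of_filtration pp ab Qa Qb QS Qc small).
Qed.

(** * A p-group whose elements trace a given subset of nat along every sequence *)

Section TraceGroup.
Variables (p : nat) (p_prime : prime p) (L : Type) (c : L -> nat -> L) (A : nat -> bool).

Definition coord_vec (m : nat) (b : L) (u : QZ) (n : nat) (t : L) : QZ :=
  if `[< n = m /\ t = b >] then u else 0.

Definition unit_vec (m : nat) (b : L) : nat -> L -> QZ := coord_vec m b (QZfrac p 1).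

(** Let e_(n, t) generate the coordinate (n, t), a copy of Z/p^(n+1).  Then
    unit_vec n t is p^n e_(n, t), and trace_vec k d is the infinite sum of
    p^(n-k) e_(n, c d n) over the n >= k in A; as p^(n-k) / p^(n+1) = 1 / p^(k+1),
    all its nonzero coordinates are equal.  The vectors trace_vec k d witness
    that the tails of trace_vec 0 d are divisible by p^k. *)
Definition trace_vec (k : nat) (d : L) (n : nat) (t : L) : QZ :=
  if `[< [/\ A n, (k <= n)%N & t = c d n] >] then QZfrac p k.+1 else 0.

Definition trace_gen (i : bool * (nat * L)) : nat -> L -> QZ :=
  if i.1 then unit_vec i.2.1 i.2.2 else trace_vec i.2.1 i.2.2.

Definition trace_subgroup : subgroup (nat -> L -> QZ) := span_subgroup trace_gen.

Definition trace_group : zmodType := subgroup_type trace_subgroup.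

Let p0 : (0 < p)%N := prime_gt0 p_prime.

Lemma QZfrac_exponent k n : (k <= n)%N -> QZfrac p k *+ p ^ n = 0.
Proof.
move=> kn; rewrite -(subnKC kn) expnD mulrnA.
by have := QZfrac_expn 0 k p0; rewrite add0n QZfrac0 => ->; rewrite mul0rn.
Qed.

(** A multiple of p^(n+1) in the trace group vanishes at the coordinates (n, t);
    this is what reveals that n is in A. *)
Lemma trace_exponent (x : trace_group) n t : sgval x n t *+ p ^ n.+1 = 0.
Proof.
pose E z := forall n t, (z : nat -> L -> QZ) n t *+ p ^ n.+1 = 0.
have EB y z : E y -> E z -> E (y - z).
  by move=> Ey Ez m u; rewrite -[(y - z) m u]/(y m u - z m u) mulrnBl Ey Ez subr0.
have E0 : E 0 by move=> m u; rewrite mul0rn.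
apply: (span_ind (S := Subgroup E0 EB) _ (sgvalP x)) => -[[] [k d]] m u /=.
  by rewrite /trace_gen /= /unit_vec /coord_vec; case: ifP => _; rewrite ?mul0rn // QZfrac_exponent.
rewrite /trace_gen /= /trace_vec; case: asboolP => [[_ km _]|_]; last by rewrite mul0rn.
by rewrite QZfrac_exponent.
Qed.

Lemma trace_p_torsion : p_torsion p trace_group.
Proof.
move=> x; pose E z := exists k, (z : nat -> L -> QZ) *+ p ^ k = 0.
have EB y z : E y -> E z -> E (y - z).
  move=> [k hy] [l hz]; exists (k + l)%N.
  by rewrite expnD mulrnBl mulrnA hy mul0rn mulnC mulrnA hz mul0rn subr0.
have E0 : E 0 by exists 0%N; rewrite mul0rn.
have [|k xk] := span_ind (S := Subgroup E0 EB) _ (sgvalP x).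
  move=> [[] [k d]] /=; exists k.+1; apply/funext => m; apply/funext => u.
    by rewrite !fctMn /trace_gen /= /unit_vec /coord_vec; case: ifP => _; rewrite ?mul0rn // QZfrac_exponent.
  by rewrite !fctMn /trace_gen /= /trace_vec; case: ifP => _; rewrite ?mul0rn // QZfrac_exponent.
by exists k; apply: sgval_inj; rewrite sgvalMn xk sgval0.
Qed.

Lemma embeds_trace : embeds nat L -> embeds (L * L) L -> embeds trace_group L.
Proof.
move=> nL LL; apply: (@embeds_trans {v | span trace_gen v}).
  exists (fun x : trace_group => exist _ (sgval x) (sgvalP x)).
  by move=> x y /(congr1 sval)/sgval_inj.
apply: embeds_trans (embeds_span _) _.
have bn : embeds bool nat by exists nat_of_bool => -[] [].
have bL := embeds_trans bn nL.
have IL : embeds (bool * (nat * L) * bool) L.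
  apply: (embeds_trans _ LL); apply: (embeds_prod _ bL).
  apply: (embeds_trans _ LL); apply: (embeds_prod bL).
  by apply: (embeds_trans _ LL); apply: (embeds_prod nL (embeds_refl L)).
have IN : embeds nat (bool * (nat * L) * bool).
  by have [e eI] := nL; exists (fun n => (true, (n, e 0%N), true)) => m n [].
apply: (@embeds_trans (seq L)); last exact: embeds_list.
have [h hI] := IL; exists (map h); exact: inj_map.
Qed.

Section Support.
Variables (lt : L -> L -> Prop) (wo : strict_wo lt) (l0 : L).
Hypothesis bounded_nat : bounded lt nat.

Lemma trace_support (x : trace_group) :
  exists b, forall n t, sgval x n t <> 0 -> lt t b.
Proof.
pose E z := exists b, forall n t, (z : nat -> L -> QZ) n t <> 0 -> lt t b.
have EB y z : E y -> E z -> E (y - z).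
  move=> [b1 h1] [b2 h2]; have [b [bb1 bb2]] := wo_max2 wo b1 b2; exists b => n t yz.
  have [/h1 tb|/contrapT y0] := pselect (y n t <> 0); first exact: (wo_lt_le wo tb bb1).
  have [/h2 tb|/contrapT z0] := pselect (z n t <> 0); first exact: (wo_lt_le wo tb bb2).
  by case: yz; rewrite -[LHS]/(y n t - z n t) y0 z0 subr0.
have E0 : E 0 by exists l0.
apply: (span_ind (S := Subgroup E0 EB) _ (sgvalP x)) => -[[] [k d]] /=.
  have [b bP] := bounded_nat (fun=> d); exists b => n t.
  by rewrite /trace_gen /unit_vec /coord_vec /=; case: asboolP => // -[_ ->] _; exact: (bP 0%N).
have [b bP] := bounded_nat (c d); exists b => n t.
by rewrite /trace_gen /trace_vec /=; case: asboolP => // -[_ _ ->] _; exact: bP.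
Qed.

End Support.

Lemma trace_vecS k d : trace_vec k d =
  trace_vec k.+1 d *+ p + (if A k then coord_vec k (c d k) (QZfrac p k.+1) else 0).
Proof.
apply/funext => n; apply/funext => t.
rewrite -[RHS]/((trace_vec k.+1 d *+ p) n t + _) !fctMn /trace_vec.
have coordF (m : nat) (b : L) (u : QZ) : ~ (n = m /\ t = b) ->
    (if A k then coord_vec m b u else 0) n t = 0.
  by move=> nm; case: ifP => // _; rewrite /coord_vec asboolF.
have [tc|tc] := pselect (t = c d n); last first.
  rewrite asboolF; last by case.
  rewrite asboolF; last by case.
  by rewrite mul0rn add0r coordF // => -[nk tk]; apply: tc; rewrite tk nk.
case: (ltngtP k n) => kn.
- rewrite coordF; last by move=> [nk _]; rewrite nk ltnn in kn.
  by rewrite addr0; case: ifP => _; rewrite ?mul0rn ?QZfracS.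
- rewrite asboolF; last by case.
  by rewrite mul0rn add0r coordF // => -[nk _]; rewrite nk ltnn in kn.
- subst n; rewrite [in RHS]asboolF; last by case.
  rewrite mul0rn add0r; case: (A k); last by rewrite asboolF //; case.
  by rewrite /coord_vec !asboolT.
Qed.

Lemma trace_vec_step k d : trace_vec k d *+ p ^ k =
  trace_vec k.+1 d *+ p ^ k.+1 + (if A k then unit_vec k (c d k) else 0).
Proof.
rewrite {1}trace_vecS mulrnDl -mulrnA -expnS; congr (_ + _).
case: ifP => _; last by rewrite mul0rn.
apply/funext => n; apply/funext => t; rewrite !fctMn /unit_vec /coord_vec.
case: ifP => _; last by rewrite mul0rn.
by rewrite -add1n QZfrac_expn.
Qed.

Definition unit_elt_ex m b : exists x : trace_group, sgval x = unit_vec m b :=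
  sgval_ex (span_gen trace_gen (true, (m, b)) : trace_subgroup _).

Definition trace_elt_ex k d : exists x : trace_group, sgval x = trace_vec k d :=
  sgval_ex (span_gen trace_gen (false, (k, d)) : trace_subgroup _).

End TraceGroup.

(** * Universality below the continuum *)

(** Let F x dominate all Phi k y z with y, z <= x. *)
Lemma closed_under_binary K L (lt : L -> L -> Prop) (Phi : K -> L -> L -> L) :
  strict_wo lt -> (forall x, bounded lt ({y | ~ lt x y} * {y | ~ lt x y} * K)) ->
  exists F : L -> L, forall a, closed_under lt F a ->
    forall k y z, lt y a -> lt z a -> lt (Phi k y z) a.
Proof.
move=> wo bd.
have /choice[F FP] : forall x, exists b, forall s : {y | ~ lt x y} * {y | ~ lt x y} * K,
    lt (Phi s.2 (sval s.1.1) (sval s.1.2)) b by move=> x; exact: bd.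
exists F => a cl k y z ya za; have [xy|xy] := pselect (lt y z).
  apply: wo_trans (cl z za) => //.
  exact: (FP z (exist _ y (wo_asym wo xy), exist _ z (@wo_irr _ _ wo z), k)).
apply: wo_trans (cl y ya) => //.
exact: (FP y (exist _ y (@wo_irr _ _ wo y), exist _ z xy, k)).
Qed.

(** The trace of u along a sequence a : nat -> L records the n for which u is not
    congruent mod p^(n+1) to an element numbered below a n.  For L many
    sequences there are at most L many traces in U; if the continuum did not embed
    into L, some set A would not be among them.  The trace group of A has, for each d,
    an element x_d = sum over n in A of p^n e_(n, c d n) with trace A along c d.
    A pure embedding f into U preserves traces along those sequences all of
    whose terms are closed under suitable functions, and club guessing provides
    such a sequence. *)
Theorem continuum_embeds p (L : Type) (lt : L -> L -> Prop) (U : zmodType) :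
  prime p -> strict_wo lt -> bounded lt nat ->
  (forall x, bounded lt ({y | ~ lt x y} * {y | ~ lt x y} * (nat * nat))) ->
  embeds nat L -> embeds (L * L) L ->
  (exists c : L -> nat -> L, forall F, exists d,
    (forall n, lt (c d n) (c d n.+1)) /\ forall n, closed_under lt F (c d n)) ->
  embeds U L ->
  (forall G : zmodType, p_torsion p G -> embeds G L ->
    exists f : {additive G -> U}, pure_embedding f) ->
  embeds (nat -> bool) L.
Proof.
move=> pp wo bnat bseg nL LL [c0 c0P] [num numI] univ; apply: contrapT => small.
have [[l0 _] p0] : embeds nat L /\ (0 < p)%N by split=> //; exact: prime_gt0.
(* Shifting by one ensures that some element of L lies below each term. *)
pose c d n := c0 d n.+1.
pose trace_hit (u : U) d n := exists g h, lt (num g) (c d n) /\ u = g + h *+ p ^ n.+1.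
have [A AP] : exists A : nat -> bool, forall u d,
    exists n, ~ (A n <-> ~ trace_hit u d n).
  apply: contrapT => all; apply: small.
  apply: (@embeds_trans (U * L)); last first.
    apply: embeds_trans LL; apply: embeds_prod (embeds_refl L); by exists num.
  apply: (embeds_surj (g := fun ud n => `[< ~ trace_hit ud.1 ud.2 n >])) => A.
  apply: contrapT => nA; apply: all; exists A => u d; apply: contrapT => h.
  apply: nA; exists (u, d); apply/funext => n /=.
  have [Ah hA] : A n <-> ~ trace_hit u d n by apply: contrapT => ?; apply: h; exists n.
  by apply/asboolP/idP => [/hA|/Ah].
have [f /pure_embedding_pure_hom[fI fpure]] := univ (trace_group p c A)
  (trace_p_torsion (A := A) pp (c := c)) (embeds_trace p c A nL LL).
have /choice[e eE] := fun mb : nat * L => unit_elt_ex p c A mb.1 mb.2.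
have /choice[y yE] := fun kd : nat * L => trace_elt_ex p c A kd.1 kd.2.
have /choice[inv invP] : forall l, exists u : U, forall u', num u' = l -> u = u'.
  move=> l; have [[u ul]|n] := pselect (exists u, num u = l).
    by exists u => u' u'l; apply: numI; rewrite ul.
  by exists 0 => u' u'l; case: n; exists u'.
have invK u : inv (num u) = u by exact: invP.
(* A preimage of g modulo p^(n+1), when there is one, with a bound on its support. *)
have /choice[bd bdP] : forall gn : U * nat, exists b, forall x h,
    f x = gn.1 + h *+ p ^ gn.2.+1 -> exists x' h',
    f x' = gn.1 + h' *+ p ^ gn.2.+1 /\ forall n t, sgval x' n t <> 0 -> lt t b.
  move=> [g n] /=.
  have [[x [h xh]]|no] := pselect (exists x h, f x = g + h *+ p ^ n.+1).
    have [b bP] := trace_support wo (l0 0%N) bnat x.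
    by exists b => _ _ _; exists x, h.
  by exists (l0 0%N) => x h xh; case: no; exists x, h.
pose Phi (k : nat * nat) a b := match k.1 with
  | 0%N => num (inv a + inv b)
  | 1%N => num (f (e (k.2, a)))
  | 2%N => bd (inv a, k.2)
  | _ => num 0 end.
have [F FP] := closed_under_binary Phi wo bseg.
have [d [dinc0 dcl0]] := c0P F.
have dinc n : lt (c d n) (c d n.+1) by exact: dinc0.
have dcl n := FP _ (dcl0 n.+1).
have dlow n : exists a, lt a (c d n) by exists (c0 d n).
have dmono m n : (m < n)%N -> lt (c d m) (c d n).
  elim: n => // n IH; rewrite ltnS leq_eqVlt => /predU1P[-> //|/IH mn].
  exact: (wo_trans wo mn).
(* The initial part of the sum defining x_d. *)
have init n : exists z, sgval (y (0%N, d)) = sgval z + sgval (y (n, d)) *+ p ^ n /\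
    forall m, (n <= m)%N -> lt (num (f z)) (c d m).
  elim: n => [|n [z [zE zlt]]].
    exists 0; split; first by rewrite sgval0 add0r.
    move=> m _; rewrite raddf0; have [a am] := dlow m.
    exact: (dcl m (3%N, 0%N) a a am am).
  pose w := if A n then e (n, c d n) else 0.
  exists (z + w); split.
    have -> : sgval (z + w) = sgval z + (if A n then unit_vec p n (c d n) else 0).
      by rewrite sgvalD /w; case: ifP => _; rewrite ?eE ?sgval0.
    by rewrite zE !yE /= trace_vec_step // addrA addrAC.
  move=> m nm; rewrite raddfD.
  have zm : lt (num (f z)) (c d m) by apply: zlt; exact: ltnW.
  have wm : lt (num (f w)) (c d m).
    rewrite /w; case: ifP => _; last first.
      by rewrite raddf0; exact: (dcl m (3%N, 0%N) _ _ zm zm).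
    have nm' := dmono _ _ nm.
    exact: (dcl m (1%N, n) _ _ nm' nm').
  have := dcl m (0%N, 0%N) _ _ zm wm.
  by rewrite /Phi /= !invK.
(* Let x_d be y (0, d).  If n is in A and f x_d is g modulo p^(n+1) with g numbered
   below c d n, then g has a preimage x' modulo p^(n+1) supported below c d n, so
   x_d - x' is a multiple of p^(n+1) with a nonzero coordinate (n, c d n). *)
have [n] := AP (f (y (0%N, d))) d; apply; split=> [An [g [h [gn xE]]]|nhit].
  have [x' [h' [x'E x'supp]]] := bdP (g, n) _ _ xE; simpl in x'E.
  have [x1 x1E] : exists x1, y (0%N, d) - x' = x1 *+ p ^ n.+1.
    apply: (fpure _ _ (h - h')).
    by rewrite raddfB xE x'E mulrnBl opprD addrACA subrr add0r.
  have := congr1 (fun z : trace_group p c A => sgval z n (c d n)) x1E.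
  rewrite sgvalMn !fctMn trace_exponent // sgvalB.
  rewrite -[(_ - _) n (c d n)]/(sgval (y (0%N, d)) n (c d n) - sgval x' n (c d n)).
  have -> : sgval x' n (c d n) = 0.
    apply: contrapT => /x'supp; apply: (wo_asym wo).
    have := dcl n (2%N, n) _ _ gn gn; by rewrite /Phi /= invK.
  rewrite subr0 yE /= /trace_vec asboolT //.
  exact: QZfrac1_neq0 (prime_gt1 pp).
(* If n is not in A, then x_d is its initial part plus a multiple of p^(n+1). *)
apply: contrapT => nAn; apply: nhit; have [z [zE zlt]] := init n.
exists (f z), (f (y (n.+1, d))); split; first exact: zlt.
rewrite -raddfMn -raddfD; congr (f _); apply: sgval_inj.
rewrite zE !yE /= trace_vec_step // (negbTE (introN idP nAn)) addr0.
by rewrite sgvalMn yE.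
Qed.

Local Close Scope ring_scope.

(** The value n.+2 leaves room for aleph_1 strictly below L, along which the
    club guessing argument iterates. *)
Lemma universal_aleph_continuum p n L (U : zmodType) : prime p -> is_aleph n.+2 L ->
  universal_pgroup p L U -> embeds (nat -> bool) L.
Proof.
move=> pp Ln [_ /card_eq_embeds[UL _] univ].
have [S [lt [Sn wo LS bS seg]]] := aleph_succ_regular Ln.
have [nS SS] := aleph_square Sn; have [nL LL] := aleph_square Ln.
have l0 : L by case: (cid nL) => e _; exact: e 0.
have [W [W1 WS]] := aleph1_below Sn.
have [R [ltW [R0 woW _ bR _]]] := aleph_succ_regular W1.
have [nR _] := aleph_square R0; have [nW _] := aleph_square W1.
have w0 : W by case: (cid nW) => e _; exact: e 0.
have bWn : bounded ltW nat := boundedS w0 nR bR.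
have bd T : embeds T S -> bounded lt T by move=> TS; exact: (boundedS l0 TS bS).
have bseg x : bounded lt ({y | ~ lt x y} * {y | ~ lt x y} * (nat * nat)).
  apply: bd; apply: (embeds_trans _ SS); apply: embeds_prod.
    exact: embeds_trans (embeds_prod (seg x) (seg x)) SS.
  exact: embeds_trans (embeds_prod nS nS) SS.
apply: (continuum_embeds pp wo (bd _ nS) bseg nL LL _ UL).
  exact: (club_guessing wo (bd _ nS) (fun x => bd _ (seg x)) woW w0 bWn (bd _ WS) l0).
move=> G /(abelian_pgroupP _ pp) pG GL; apply: univ => //.
exact/card_le_embeds.
Qed.

Local Open Scope classical_set_scope.
Local Open Scope card_scope.

Theorem theorem0p1 (p : nat) (p_prime : prime p) :
  (forall L : Type, infinite_set [set: L] ->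
     [set: nat -> L] #= [set: L] \/
       (forall M : Type, card_lt M L -> card_lt (nat -> M) L) ->
     exists U : zmodType, universal_pgroup p L U) /\
  (forall (n : nat) (L : Type), (2 <= n)%N -> is_aleph n L ->
     (exists U : zmodType, universal_pgroup p L U) <->
     [set: nat -> bool] #<= [set: L]).
Proof.
split=> [L /infinite_embeds nL hL|[|[|n]] // L _ Ln].
  apply: universal_exists => //.
  case: hL => [/card_eq_embeds[LL _]|small]; [by left | right=> M /card_lt_embeds ML].
  by apply/card_lt_embeds; exact: small.
split=> [[U universalU]|/card_le_embeds cL].
  by apply/card_le_embeds; exact: (universal_aleph_continuum p_prime Ln universalU).
have [nL _] := aleph_square Ln; apply: universal_exists => //.
by left; exact: (aleph_power Ln cL).
Qed.
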